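(* Let $\varepsilon_0,\rho_0>0$ be given and let $\Omega\subset\mathbb R^n$ be a nonempty compact set. Assume that $f:\mathbb R^n\times\mathbb R^m\to\mathbb R$ is continuously differentiable and $\tilde f:\mathbb R^n\times\mathbb R^m\to\mathbb R$ is twice continuously differentiable, that $\tilde f(x',\cdot)$ is strongly convex with modulus $\sigma>0$ for all $x'$ in an open set $\mathcal N$ containing $\Omega$, that $\nabla f(x',\cdot)$ is $L_1$-Lipschitz continuous for all $x'\in\Omega$, and that $\nabla^2\tilde f(x',\cdot)$ is $L_2$-Lipschitz continuous for all $x'\in\Omega$. Suppose that $(x,y)\in\Omega\times\mathbb R^m$ is an $\varepsilon$-KKT solution of the problem $\min\{f(x,y): y\in\operatorname{argmin}_z\tilde f(x,z)\}$ with its associated $\rho\ge\rho_0$, for some $0<\varepsilon\le\varepsilon_0$. Let $$\bar C=\max\big\{\|\nabla_y f(x',y')\| : x'\in\Omega,\ \|y'-y^*(x')\|\le\sqrt{2\sigma^{-1}\varepsilon}\big\},$$ $$\theta=\min\big\{(\rho\sigma)^{-1}(\varepsilon+\bar C),\ \sqrt{2\sigma^{-1}\varepsilon}\big\},\qquad C=\max_{x'\in\Omega}\big\|\nabla^2_{xy}\tilde f(x',y^*(x'))[\nabla^2_{yy}\tilde f(x',y^*(x'))]^{-1}\big\|.$$ Then $$\|\nabla\Phi(x)\|\le(2C+1)\varepsilon+(C+1)\Big(L_1\theta+\frac{L_2\rho\theta^2}{2}+\frac{L_2\varepsilon^2}{2\rho\sigma^2}\Big)$$ $$\le(2C+1)\varepsilon+(C+1)\Big(L_1\sqrt{2\sigma^{-1}}+\frac{L_2\sigma^{-3/2}(\varepsilon_0+\bar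 C)}{\sqrt2}+\frac{\varepsilon_0^{3/2}L_2}{2\rho_0\sigma^2}\Big)\sqrt{\varepsilon}.$$
   Context: $\|\cdot\|$ is the Euclidean norm on vectors and the induced operator (spectral) norm on matrices. $y^*(x')=\operatorname{argmin}_z\tilde f(x',z)$ (a single point for $x'\in\mathcal N$) and $\Phi(x')=f(x',y^*(x'))$ is the hyper-objective function. $\nabla^2_{xy}\tilde f$ is the $n\times m$ matrix with entries $\partial^2\tilde f/\partial x_i\partial y_j$ and $\nabla^2_{yy}\tilde f$ is the $m\times m$ Hessian in $y$. The gradient of $\Phi$ (hypergradient) is $$\nabla\Phi(x)=\nabla_xf(x,y^*(x))-\nabla^2_{xy}\tilde f(x,y^*(x))[\nabla^2_{yy}\tilde f(x,y^*(x))]^{-1}\nabla_yf(x,y^*(x)).$$ $\varepsilon$-KKT solution (for differentiable $f,\tilde f$): $(x,y)$ is an $\varepsilon$-KKT solution of $\min\{f(x,y): y\in\operatorname{argmin}_z\tilde f(x,z)\}$ if there exists $(z,\rho)\in\mathbb R^m\times\mathbb R_+$ (this $\rho$ is the associated $\rho$) such that $$\big\|\nabla f(x,y)+\rho\nabla\tilde f(x,y)-(\rho\nabla_x\tilde f(x,z);0)\big\|\le\varepsilon,\quad \|\rho\nabla_z\tilde f(x,z)\|\le\varepsilon,\quad \tilde f(x,y)-\min_{z'}\tilde f(x,z')\le\varepsilon,$$ where $(u;v)$ denotes stacking $v$ under $u$ and $\nabla_z\tilde f(x,z)$ is the gradient with respect to the second argument. *)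

(* Defs.v *)
From mathcomp Require Import all_boot all_order all_algebra.
From mathcomp Require Import all_classical all_reals all_analysis.

Set Implicit Arguments.
Unset Strict Implicit.
Unset Printing Implicit Defensive.

Import Order.TTheory GRing.Theory Num.Theory.
Import numFieldNormedType.Exports.

Local Open Scope classical_set_scope.
Local Open Scope ring_scope.

(* Vectors are row vectors, and R^n x R^m is identified with R^(n+m) through
   row_mx, so that f(x, y) is written f (row_mx x y) and the stacked vector
   (u; v) is row_mx u v. The norm of the normed module 'rV[R]_n is the sup
   norm: it is used only for its topology and for differentiability, which do
   not depend on the choice of a norm; all the estimates use enorm. *)

Definition enorm (R : realType) (k : nat) (v : 'rV[R]_k) : R :=
  Num.sqrt (\sum_(i < k) v 0 i ^+ 2).

(* v *m A^T is the row vector representing A v; the bound enorm v <= 1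
   (rather than an equality) keeps the set nonempty when q = 0. *)
Definition opnorm (R : realType) (p q : nat) (A : 'M[R]_(p, q)) : R :=
  sup [set enorm (v *m A^T) | v in [set v : 'rV[R]_q | enorm v <= 1]].

Definition grad (R : realType) (k : nat) (g : 'rV[R]_k -> R) (p : 'rV[R]_k) :
    'rV[R]_k :=
  \row_(i < k) 'D_(delta_mx 0 i) g p.

(* The entry (i, j) is the partial derivative with respect to the i-th
   variable of the partial derivative with respect to the j-th variable. *)
Definition hess (R : realType) (k : nat) (g : 'rV[R]_k -> R) (p : 'rV[R]_k) :
    'M[R]_k :=
  \matrix_(i < k, j < k) grad (fun q => grad g q 0 j) p 0 i.

Definition C1 (R : realType) (k : nat) (g : 'rV[R]_k -> R) : Prop :=
  (forall p, differentiable g p) /\ continuous (grad g).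

Definition C2 (R : realType) (k : nat) (g : 'rV[R]_k -> R) : Prop :=
  C1 g /\ forall i : 'I_k, C1 (fun p => grad g p 0 i).

Definition strongly_convex (R : realType) (k : nat) (sigma : R)
    (g : 'rV[R]_k -> R) : Prop :=
  forall (u v : 'rV[R]_k) (t : R), 0 <= t <= 1 ->
    g (t *: u + (1 - t) *: v) <=
      t * g u + (1 - t) * g v - sigma / 2 * t * (1 - t) * enorm (u - v) ^+ 2.

Definition argmin (R : realType) (k : nat) (g : 'rV[R]_k -> R) :
    set 'rV[R]_k :=
  [set y | forall z, g y <= g z].

Definition is_max (R : realType) (S : set R) (M : R) : Prop :=
  S M /\ ubound S M.

Section TwoVariables.
Context {R : realType} {n m : nat}.
Implicit Types (f ft : 'rV[R]_(n + m) -> R) (p : 'rV[R]_(n + m)).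
Implicit Types (x : 'rV[R]_n) (y z : 'rV[R]_m).

Definition gradx f p : 'rV[R]_n := lsubmx (grad f p).

Definition grady f p : 'rV[R]_m := rsubmx (grad f p).

Definition hessxy f p : 'M[R]_(n, m) := ursubmx (hess f p).

Definition hessyy f p : 'M[R]_m := drsubmx (hess f p).

(* The value is unspecified at the points x where ft(x, .) has no minimizer. *)
Definition ystar ft x : 'rV[R]_m :=
  get (argmin (fun z => ft (row_mx x z))).

Definition hyper_objective f ft x : R := f (row_mx x (ystar ft x)).

(* (x, y) is an eps-KKT solution of min { f(x, y) : y in argmin_z ft(x, z) }
   with associated multiplier rho. *)
Definition eps_KKT_with f ft (eps : R) x y (rho : R) : Prop :=
  0 <= rho /\
  exists z : 'rV[R]_m,
    [/\ enorm (grad f (row_mx x y) + rho *: grad ft (row_mx x y)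
               - row_mx (rho *: gradx ft (row_mx x z)) 0) <= eps,
        enorm (rho *: grady ft (row_mx x z)) <= eps
      & ft (row_mx x y) - inf (range (fun z' => ft (row_mx x z'))) <= eps].

End TwoVariables.

(* Main.v *)
Require Import Defs.
From HB Require Import structures.
From mathcomp Require Import all_boot all_order all_algebra.
From mathcomp Require Import all_classical all_reals all_analysis.
From mathcomp Require Import ring lra.
Import Order.TTheory GRing.Theory Num.Theory.
Import numFieldNormedType.Exports.
Local Open Scope classical_set_scope.
Local Open Scope ring_scope.

(** The lower level solution map [ystar] is well defined and differentiable on
    [N], because strong convexity gives the error bound
    [sigma |y - ystar x| <= |grady ft (x, y)|] ([ystar_dist_grady]). Applied to
    the first order candidate [ystar x - h *m K], with
    [K = hessxy *m hessyy^-1], it shows directly that [ystar] has derivative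
    [- K] ([ystar_expansion]); the chain rule then gives the hypergradient
    [gradx f - grady f *m K^T] ([hyper_objective_grad]). Since [ystar] is
    continuous on [N], the two suprema [Cbar] and [C] range over continuous
    images of compact sets and are attained ([grady_tube_max],
    [sensitivity_opnorm_max]).

    For the estimate, let [s = (x, ystar x)] and let [P] be the linear map
    [(a; b) |-> a - b *m K^T], whose norm is at most [C + 1]. The hypergradient
    is the image of [grad f s]. The KKT conditions express [grad f (x, y)] as a
    residual of size [eps] minus [rho] times the difference of the gradients of
    [ft] at [(x, y)] and [(x, z)], up to a second residual in the [y] block.
    Expanding these gradients around [s], the linear terms are of the form
    [(0; v)] times the Hessian, and [P] annihilates them by the definition of
    [K] and the symmetry of the Hessian ([hess_sym]). Only Taylor remainders,
    quadratic in the distances of [y] and [z] to [ystar x], are multiplied by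
    [rho] ([grad_taylor], [hypergradient_bound]).

    It remains to bound these distances. The value gap and quadratic growth
    give [|y - ystar x| <= sqrt (2 eps / sigma)]; the error bound and the KKT
    conditions give [|y - ystar x| <= (eps + Cbar) / (rho sigma)] and
    [|z - ystar x| <= eps / (rho sigma)]. This is the first inequality, and
    [error_terms_sqrt_bound] derives the second one by real arithmetic. *)

(** * The Euclidean inner product and norm *)

Definition dot {R : realType} {k : nat} (u v : 'rV[R]_k) : R :=
  \sum_(i < k) u 0 i * v 0 i.

Lemma dotC {R : realType} {k : nat} (u v : 'rV[R]_k) : dot u v = dot v u.
Proof. by apply: eq_bigr => i _; rewrite mulrC. Qed.

Lemma dotDr {R : realType} {k : nat} (u v w : 'rV[R]_k) :
  dot u (v + w) = dot u v + dot u w.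
Proof. by rewrite -big_split; apply: eq_bigr => i _; rewrite mxE mulrDr. Qed.

Lemma dotZr {R : realType} {k : nat} (a : R) (u v : 'rV[R]_k) :
  dot u (a *: v) = a * dot u v.
Proof. by rewrite mulr_sumr; apply: eq_bigr => i _; rewrite mxE mulrCA. Qed.

Lemma dotNr {R : realType} {k : nat} (u v : 'rV[R]_k) : dot u (- v) = - dot u v.
Proof. by rewrite -scaleN1r dotZr mulN1r. Qed.

Lemma dotBr {R : realType} {k : nat} (u v w : 'rV[R]_k) :
  dot u (v - w) = dot u v - dot u w.
Proof. by rewrite dotDr dotNr. Qed.

Lemma dotBl {R : realType} {k : nat} (u v w : 'rV[R]_k) :
  dot (v - w) u = dot v u - dot w u.
Proof. by rewrite -!(dotC u) dotBr. Qed.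

Lemma dot0r {R : realType} {k : nat} (u : 'rV[R]_k) : dot u 0 = 0.
Proof. by rewrite -(scale0r 0) dotZr mul0r. Qed.

Lemma dot_row_mx {R : realType} {n m : nat} (u u' : 'rV[R]_n) (v v' : 'rV[R]_m) :
  dot (row_mx u v) (row_mx u' v') = dot u u' + dot v v'.
Proof.
rewrite /dot big_split_ord/=; congr (_ + _); apply: eq_bigr => i _.
  by rewrite !row_mxEl.
by rewrite !row_mxEr.
Qed.

Lemma dot_mulmx {R : realType} {n m : nat} (u : 'rV[R]_m) (v : 'rV[R]_n)
    (A : 'M[R]_(n, m)) :
  dot u (v *m A) = dot (u *m A^T) v.
Proof.
have dotE p (a b : 'rV[R]_p) : dot a b = (a *m b^T) 0 0.
  by rewrite mxE; apply: eq_bigr => i _; rewrite mxE.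
by rewrite !dotE trmx_mul mulmxA.
Qed.

Lemma dot_delta {R : realType} {k : nat} (u : 'rV[R]_k) i :
  dot u (delta_mx 0 i) = u 0 i.
Proof.
rewrite /dot (bigD1 i) //= big1 => [|j ji].
  by rewrite mxE !eqxx mulr1 addr0.
by rewrite mxE (negbTE ji) andbF mulr0.
Qed.

Lemma enorm_ge0 {R : realType} {k : nat} (v : 'rV[R]_k) : 0 <= enorm v.
Proof. exact: sqrtr_ge0. Qed.

Lemma dot_enorm {R : realType} {k : nat} (v : 'rV[R]_k) : dot v v = enorm v ^+ 2.
Proof.
have E : dot v v = \sum_(i < k) v 0 i ^+ 2 by apply: eq_bigr => i _; rewrite expr2.
by rewrite /enorm sqr_sqrtr -?E // E sumr_ge0 // => i _; rewrite sqr_ge0.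
Qed.

Lemma enorm_eq0 {R : realType} {k : nat} (v : 'rV[R]_k) : enorm v = 0 -> v = 0.
Proof.
move=> v0; have /eqP := dot_enorm v; rewrite v0 expr0n /= psumr_eq0; last first.
  by move=> i _; rewrite -expr2 sqr_ge0.
move=> /allP h; apply/rowP => i; have := h i (mem_index_enum _).
by rewrite mxE /= mulf_eq0 orbb => /eqP.
Qed.

Lemma enorm0 {R : realType} {k : nat} : enorm (0 : 'rV[R]_k) = 0.
Proof. by apply/eqP; rewrite -sqrf_eq0 -dot_enorm dot0r. Qed.

Lemma enormZ {R : realType} {k : nat} (a : R) (v : 'rV[R]_k) :
  enorm (a *: v) = `|a| * enorm v.
Proof.
apply/eqP; rewrite -(eqrXn2 (n := 2)) ?mulr_ge0 ?enorm_ge0 //.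
by rewrite exprMn -!dot_enorm dotZr dotC dotZr mulrA -expr2 real_normK // num_real.
Qed.

Lemma enormN {R : realType} {k : nat} (v : 'rV[R]_k) : enorm (- v) = enorm v.
Proof. by rewrite -scaleN1r enormZ normrN1 mul1r. Qed.

Lemma enormBC {R : realType} {k : nat} (u v : 'rV[R]_k) :
  enorm (u - v) = enorm (v - u).
Proof. by rewrite -enormN opprB. Qed.

(** Cauchy-Schwarz, from [0 <= |a v - b u|^2] with [a = |u|] and [b = |v|]. *)
Lemma dot_le_enorm {R : realType} {k : nat} (u v : 'rV[R]_k) :
  dot u v <= enorm u * enorm v.
Proof.
set a := enorm u; set b := enorm v.
have a0 : 0 <= a by exact: enorm_ge0.
have b0 : 0 <= b by exact: enorm_ge0.
have := sqr_ge0 (enorm (a *: v - b *: u)).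
rewrite -dot_enorm dotBr !dotBl !dotZr !(dotC _ v) !(dotC _ u) !dotZr !dot_enorm.
rewrite -/a -/b (dotC v u) => h.
have {}h : 0 <= 2 * (a * b) * (a * b - dot u v).
  by apply: le_trans h _; rewrite le_eqVlt; apply/orP; left; apply/eqP; ring.
have := mulr_ge0 a0 b0; rewrite le0r => /orP[/eqP ab0|ab0].
  have [/enorm_eq0 E|/enorm_eq0 E] : a = 0 \/ b = 0.
  - by move/eqP: ab0; rewrite mulf_eq0 => /orP[] /eqP; [left|right].
  - by rewrite dotC E dot0r /a E mulr_ge0 ?enorm_ge0.
  - by rewrite E dot0r mulr_ge0.
by rewrite -subr_ge0 -(pmulr_rge0 _ (_ : 0 < 2 * (a * b))) // mulr_gt0.
Qed.

Lemma norm_dot_le {R : realType} {k : nat} (u v : 'rV[R]_k) :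
  `|dot u v| <= enorm u * enorm v.
Proof.
rewrite ler_norml dot_le_enorm andbT lerNl -dotNr -(enormN v).
exact: dot_le_enorm.
Qed.

Lemma enormD {R : realType} {k : nat} (u v : 'rV[R]_k) :
  enorm (u + v) <= enorm u + enorm v.
Proof.
rewrite -(ler_pXn2r (n := 2)) ?nnegrE ?addr_ge0 ?enorm_ge0 //.
rewrite -dot_enorm dotDr !(dotC (u + v)) !dotDr !dot_enorm (dotC v u).
by have := dot_le_enorm u v; lra.
Qed.

Lemma enormB {R : realType} {k : nat} (u v : 'rV[R]_k) :
  enorm (u - v) <= enorm u + enorm v.
Proof. by rewrite -(enormN v); exact: enormD. Qed.

Lemma dist_enorm {R : realType} {k : nat} (u v : 'rV[R]_k) :
  `|enorm u - enorm v| <= enorm (u - v).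
Proof.
have h (a b : 'rV[R]_k) : enorm a - enorm b <= enorm (a - b).
  by rewrite lerBlDr -{1}(subrK b a) enormD.
by rewrite ler_norml h andbT lerNl opprB enormBC h.
Qed.

Lemma coord_le_enorm {R : realType} {k : nat} (v : 'rV[R]_k) i :
  `|v 0 i| <= enorm v.
Proof.
rewrite -sqrtr_sqr ler_wsqrtr // (bigD1 i) //= lerDl.
by rewrite sumr_ge0 // => j _; rewrite sqr_ge0.
Qed.

Lemma enorm_le_sum {R : realType} {k : nat} (v : 'rV[R]_k) :
  enorm v <= \sum_(i < k) `|v 0 i|.
Proof.
rewrite {1}(row_sum_delta v); elim/big_ind2: _ => [|a a' b b' ha hb|i _].
- by rewrite enorm0.
- exact: le_trans (enormD _ _) (lerD ha hb).
rewrite enormZ ler_piMr // -[leRHS]sqrtr1 ler_wsqrtr // (bigD1 i) //= big1 => [|j ji].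
  by rewrite mxE !eqxx expr1n addr0.
by rewrite mxE (negbTE ji) andbF expr0n.
Qed.

Lemma mx_norm_le_enorm {R : realType} {k : nat} (v : 'rV[R]_k) : `|v| <= enorm v.
Proof.
rewrite [leLHS]/Num.norm /= mx_normrE; apply/bigmax_leP; split; first exact: enorm_ge0.
by move=> [i j] _ /=; rewrite (ord1 i) coord_le_enorm.
Qed.

Lemma coord_le_mx_norm {R : realType} {k : nat} (v : 'rV[R]_k) i :
  `|v 0 i| <= `|v|.
Proof.
rewrite [leRHS]/Num.norm /= mx_normrE; apply/bigmax_geP; right.
by exists (0, i).
Qed.

Lemma enorm_le_mx_norm {R : realType} {k : nat} (v : 'rV[R]_k) :
  enorm v <= k%:R * `|v|.
Proof.
apply: le_trans (enorm_le_sum v) _.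
rewrite mulrC mulr_natr -[X in _ *+ X]card_ord -sumr_const.
by apply: ler_sum => i _; exact: coord_le_mx_norm.
Qed.

Lemma enorm_row_mx_sqr {R : realType} {n m : nat} (u : 'rV[R]_n) (v : 'rV[R]_m) :
  enorm (row_mx u v) ^+ 2 = enorm u ^+ 2 + enorm v ^+ 2.
Proof. by rewrite -!dot_enorm dot_row_mx. Qed.

Lemma enorm_row_mx_le {R : realType} {n m : nat} (u : 'rV[R]_n) (v : 'rV[R]_m) :
  enorm (row_mx u v) <= enorm u + enorm v.
Proof.
rewrite -(ler_pXn2r (n := 2)) ?nnegrE ?addr_ge0 ?enorm_ge0 //.
rewrite enorm_row_mx_sqr.
by have := mulr_ge0 (enorm_ge0 u) (enorm_ge0 v); lra.
Qed.

Lemma enorm_row_mx0 {R : realType} {n m : nat} (v : 'rV[R]_m) :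
  enorm (row_mx (0 : 'rV[R]_n) v) = enorm v.
Proof.
apply/eqP; rewrite -(eqrXn2 (n := 2)) ?enorm_ge0 //.
by rewrite enorm_row_mx_sqr enorm0 expr0n add0r.
Qed.

Lemma enorm_lsubmx {R : realType} {n m : nat} (w : 'rV[R]_(n + m)) :
  enorm (lsubmx w) <= enorm w.
Proof.
rewrite -(ler_pXn2r (n := 2)) ?nnegrE ?enorm_ge0 //.
by rewrite -{2}(hsubmxK w) enorm_row_mx_sqr lerDl sqr_ge0.
Qed.

Lemma enorm_rsubmx {R : realType} {n m : nat} (w : 'rV[R]_(n + m)) :
  enorm (rsubmx w) <= enorm w.
Proof.
rewrite -(ler_pXn2r (n := 2)) ?nnegrE ?enorm_ge0 //.
by rewrite -{2}(hsubmxK w) enorm_row_mx_sqr lerDr sqr_ge0.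
Qed.

(** The sup norm and the Euclidean norm are equivalent, so neighbourhoods of 0
    can be described by Euclidean balls: this is the bridge between the
    topology and the estimates in [enorm]. *)
Lemma near0_enormP {R : realType} {k : nat} (P : 'rV[R]_k -> Prop) :
  (\forall h \near (0 : 'rV[R]_k), P h) <->
  exists2 d : R, 0 < d & forall h, enorm h <= d -> P h.
Proof.
split=> [/nbhs_ballP[e /= e0 eP]|[d d0 dP]].
  exists (e / 2); first by rewrite divr_gt0.
  move=> h hd; apply: eP; rewrite -ball_normE /= sub0r normrN.
  apply: le_lt_trans (mx_norm_le_enorm h) (le_lt_trans hd _).
  by rewrite ltr_pdivrMr // ltr_pMr // ltr1n.
apply/nbhs_ballP; exists (d / k.+1%:R) => /=; first by rewrite divr_gt0.
move=> h; rewrite -ball_normE /= sub0r normrN => hd; apply: dP.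
apply: le_trans (enorm_le_mx_norm h) _.
apply: le_trans (_ : k.+1%:R * `|h| <= _); first by rewrite ler_wpM2r // ler_nat.
by rewrite mulrC -ler_pdivlMr // ltW.
Qed.

(** * The operator norm *)

(** A crude upper bound of the operator norm. It makes the supremum defining
    [opnorm] finite, and being a finite sum of absolute values it transfers
    entrywise convergence to the operator norm. *)
Definition entry_sum {R : realType} {p q : nat} (A : 'M[R]_(p, q)) : R :=
  \sum_(j < q) \sum_(i < p) `|A i j|.

Lemma entry_sum_ge0 {R : realType} {p q : nat} (A : 'M[R]_(p, q)) :
  0 <= entry_sum A.
Proof. by apply: sumr_ge0 => j _; apply: sumr_ge0. Qed.

Lemma entry_sum_tr {R : realType} {p q : nat} (A : 'M[R]_(p, q)) :
  entry_sum A^T = entry_sum A.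
Proof.
rewrite /entry_sum exchange_big; apply: eq_bigr => j _; apply: eq_bigr => i _.
by rewrite mxE.
Qed.

Lemma enorm_mulmx_le {R : realType} {p q : nat} (v : 'rV[R]_p)
    (A : 'M[R]_(p, q)) :
  enorm (v *m A) <= entry_sum A * enorm v.
Proof.
apply: le_trans (enorm_le_sum _) _; rewrite mulr_suml; apply: ler_sum => j _.
rewrite mxE mulr_suml; apply: le_trans (ler_norm_sum _ _ _) _.
apply: ler_sum => i _; rewrite normrM mulrC ler_wpM2l //.
exact: coord_le_enorm.
Qed.

Lemma opnorm_has_sup {R : realType} {p q : nat} (A : 'M[R]_(p, q)) :
  has_sup [set enorm (v *m A^T) | v in [set v : 'rV[R]_q | enorm v <= 1]].
Proof.
split.
  by exists (enorm ((0 : 'rV[R]_q) *m A^T)); exists 0; rewrite //= enorm0.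
exists (entry_sum A) => _ [v /= v1 <-]; apply: le_trans (enorm_mulmx_le _ _) _.
by rewrite entry_sum_tr ler_piMr // entry_sum_ge0.
Qed.

Lemma opnorm_ge {R : realType} {p q : nat} (A : 'M[R]_(p, q)) (v : 'rV[R]_q) :
  enorm v <= 1 -> enorm (v *m A^T) <= opnorm A.
Proof.
by move=> v1; apply: ub_le_sup; [case: (opnorm_has_sup A)|exists v].
Qed.

Lemma opnorm_le {R : realType} {p q : nat} (A : 'M[R]_(p, q)) (c : R) :
  (forall v, enorm v <= 1 -> enorm (v *m A^T) <= c) -> opnorm A <= c.
Proof.
move=> H; apply: ge_sup; first by case: (opnorm_has_sup A).
by move=> _ [v /= v1 <-]; exact: H.
Qed.

Lemma opnorm_ge0 {R : realType} {p q : nat} (A : 'M[R]_(p, q)) : 0 <= opnorm A.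
Proof.
by apply: le_trans (opnorm_ge _ 0 _); rewrite ?enorm_ge0 // enorm0.
Qed.

Lemma enorm_mulmx_opnorm {R : realType} {p q : nat} (A : 'M[R]_(p, q))
    (v : 'rV[R]_q) : enorm (v *m A^T) <= opnorm A * enorm v.
Proof.
have [->|v0] := eqVneq v 0; first by rewrite mul0mx !enorm0 mulr0.
have nv : 0 < enorm v.
  by rewrite lt0r enorm_ge0 andbT; apply: contra v0 => /eqP/enorm_eq0 ->.
have : enorm (((enorm v)^-1 *: v) *m A^T) <= opnorm A.
  apply: opnorm_ge; rewrite enormZ ger0_norm ?invr_ge0 ?enorm_ge0 //.
  by rewrite mulVf // gt_eqF.
by rewrite -scalemxAl enormZ ger0_norm ?invr_ge0 ?enorm_ge0 // mulrC ler_pdivrMr.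
Qed.

Lemma opnorm_sub_le {R : realType} {p q : nat} (A B : 'M[R]_(p, q)) :
  opnorm A - opnorm B <= entry_sum (A - B).
Proof.
rewrite lerBlDr; apply: opnorm_le => v v1.
rewrite -[A in leLHS](subrK B) linearD mulmxDr.
apply: le_trans (enormD _ _) (lerD _ (opnorm_ge _ _ v1)).
apply: le_trans (enorm_mulmx_le _ _) _.
by rewrite entry_sum_tr ler_piMr // entry_sum_ge0.
Qed.

Lemma entry_sumN {R : realType} {p q : nat} (A : 'M[R]_(p, q)) :
  entry_sum (- A) = entry_sum A.
Proof. by apply: eq_bigr => j _; apply: eq_bigr => i _; rewrite mxE normrN. Qed.

Lemma dist_opnorm {R : realType} {p q : nat} (A B : 'M[R]_(p, q)) :
  `|opnorm A - opnorm B| <= entry_sum (A - B).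
Proof.
rewrite ler_norml opnorm_sub_le andbT lerNl opprB -entry_sumN opprB.
exact: opnorm_sub_le.
Qed.

Lemma dot_linear {R : realType} {k : nat} (u : 'rV[R]_k) : linear (dot u).
Proof. by move=> a v w; rewrite dotDr dotZr. Qed.

HB.instance Definition _ {R : realType} {k : nat} (u : 'rV[R]_k) :=
  GRing.isLinear.Build R 'rV[R]_k R *:%R (dot u) (dot_linear u).

Lemma dot_continuous {R : realType} {k : nat} (u : 'rV[R]_k) :
  continuous (dot u).
Proof.
apply: continuous_big => [|i _ v]; first exact: add_continuous.
apply: (@cvgM R _ (nbhs v) _ (cst (u 0 i))); first exact: cvg_cst.
exact: coord_continuous.
Qed.

(** * First order expansions in the Euclidean norm *)

Lemma diff_grad {R : realType} {k : nat} (g : 'rV[R]_k -> R) (p h : 'rV[R]_k) :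
  differentiable g p -> 'd g p h = dot (grad g p) h.
Proof.
move=> dg; rewrite {1}(row_sum_delta h) linear_sum /dot; apply: eq_bigr => i _.
by rewrite linearZ /= mxE deriveE // mulrC.
Qed.

Lemma differentiable_expansion {R : realType} {k : nat} (g : 'rV[R]_k -> R)
    (p : 'rV[R]_k) : differentiable g p ->
  forall e : R, 0 < e -> exists2 d : R, 0 < d & forall h, enorm h <= d ->
    `|g (p + h) - g p - dot (grad g p) h| <= e * enorm h.
Proof.
move=> dg e e0; apply/near0_enormP.
have /eqaddoP/(_ e e0) := diff_locally dg; apply: filterS => h.
rewrite /= opprD addrA /= => H.
rewrite addrC [p + h]addrC -diff_grad // addrC.
apply: le_trans H _; rewrite ler_wpM2l ?(ltW e0) //.
exact: mx_norm_le_enorm.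
Qed.

(** Converse of [differentiable_expansion]: it lets functions be shown
    differentiable, and their gradient be computed, by Euclidean estimates. *)
Lemma expansion_differentiable {R : realType} {k : nat} (g : 'rV[R]_k -> R)
    (p w : 'rV[R]_k) :
  (forall e : R, 0 < e -> exists2 d : R, 0 < d & forall h, enorm h <= d ->
    `|g (p + h) - g p - dot w h| <= e * enorm h) ->
  differentiable g p /\ grad g p = w.
Proof.
move=> H.
pose L : {linear 'rV[R]_k -> R} := dot w.
have cL : continuous L.
  exact: dot_continuous.
have E e : 0 < e -> \forall h \near (0 : 'rV[R]_k),
    `|g (h + p) - (g p + dot w h)| <= e * `|h|.
  move=> e0; have k0 : 0 < k.+1%:R :> R by [].
  have /H/near0_enormP : 0 < e / k.+1%:R by rewrite divr_gt0.
  apply: filterS => h /=; rewrite [h + p]addrC => Hh.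
  rewrite opprD addrA; apply: le_trans Hh _.
  rewrite -mulrA ler_wpM2l ?(ltW e0) // ler_pdivrMl //.
  by apply: le_trans (enorm_le_mx_norm h) _; rewrite ler_wpM2r // ler_nat.
have dE : 'd g p = L :> (_ -> _) by apply: diff_unique => //; exact/eqaddoP.
have dg : differentiable g p.
  by apply/diff_locallyP; rewrite dE; split=> //; exact/eqaddoP.
by split=> //; apply/rowP => i; rewrite mxE deriveE // dE /= dot_delta.
Qed.

Lemma is_derive_line {R : realType} {k : nat} (g : 'rV[R]_k -> R)
    (p v : 'rV[R]_k) (t : R) : differentiable g (p + t *: v) ->
  is_derive t 1 (fun s : R => g (p + s *: v)) (dot (grad g (p + t *: v)) v).
Proof.
move=> dg; pose l : R -> 'rV[R]_k := cst p + *:%R^~ v.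
have dl : is_diff t l (fun s : R => s *: v).
  have -> : (fun s : R => s *: v) = 0 + *:%R^~ v by rewrite add0r.
  exact: is_diffD.
have dc : differentiable (g \o l) t by exact: differentiable_comp.
split; first exact: diff_derivable.
rewrite (deriveE _ dc) diff_comp //= (diff_val (f := l)) scale1r.
by rewrite diff_grad.
Qed.

(** * Second derivatives *)

(** Each entry of [grad g] is differentiable with gradient a column of the
    Hessian; the factor [k.+1%:R] shares [e] between the entries. *)
Lemma grad_expansion {R : realType} {k : nat} (g : 'rV[R]_k -> R)
    (p : 'rV[R]_k) : C2 g ->
  forall e : R, 0 < e -> exists2 d : R, 0 < d & forall h, enorm h <= d ->
    enorm (grad g (p + h) - grad g p - h *m hess g p) <= e * enorm h.
Proof.
move=> [_ C2g] e e0.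
have k0 : 0 < k.+1%:R :> R by [].
pose P (j : 'I_k) (h : 'rV[R]_k) : Prop :=
    `|grad g (p + h) 0 j - grad g p 0 j - dot (grad (fun q => grad g q 0 j) p) h|
      <= e / k.+1%:R * enorm h.
have key : \forall h \near (0 : 'rV[R]_k), forall j, P j h.
  apply: (@filter_forall _ _ P _ (nbhs_filter _)) => j; apply/near0_enormP.
  by apply: differentiable_expansion (divr_gt0 e0 k0); have [] := C2g j.
move/near0_enormP: key => [d d0 H]; exists d => // h hd.
apply: le_trans (enorm_le_sum _) _.
apply: le_trans (_ : \sum_(j < k) e / k.+1%:R * enorm h <= _).
  apply: ler_sum => j _; have := H h hd j.
  rewrite /P dotC; congr (`|_| <= _).
  rewrite ![in RHS]mxE ![in LHS]mxE; congr (_ - _).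
  by apply: eq_bigr => i _; rewrite !mxE.
rewrite sumr_const card_ord -(mulr_natl _ k) !mulrA ler_wpM2r ?enorm_ge0 //.
by rewrite ler_pdivrMr // mulrC ler_wpM2l ?(ltW e0) // ler_nat.
Qed.

Lemma near_addP {R : realType} {k : nat} (p : 'rV[R]_k) (P : 'rV[R]_k -> Prop) :
  (\forall q \near p, P q) <->
  exists2 d : R, 0 < d & forall h, enorm h <= d -> P (p + h).
Proof.
rewrite (near_shift 0 p) subr0 -near0_enormP /=.
by split; apply: filterS => h /=; rewrite addrC.
Qed.

Lemma continuous_enormP {R : realType} {k : nat} (F : 'rV[R]_k -> R)
    (p : 'rV[R]_k) :
  {for p, continuous F} <->
  forall e : R, 0 < e -> exists2 d : R, 0 < d & forall h, enorm h <= d ->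
    `|F (p + h) - F p| <= e.
Proof.
split=> [cF e e0|H].
  apply/(near_addP p (fun q => `|F q - F p| <= e)).
  by have /cvgrPdist_le/(_ e e0) := cF; apply: filterS => q; rewrite distrC.
apply: (iffRL (@cvgrPdist_le _ _ _ _ (nbhs_filter p) F (F p))) => e e0.
apply/(near_addP p (fun q => `|F p - F q| <= e)).
have [d d0 Hd] := H e e0; exists d => // h hd.
by rewrite distrC; exact: Hd.
Qed.

Lemma MVT_derivable {R : realType} (F dF : R -> R) (t : R) : 0 < t ->
  (forall s : R, is_derive s 1 F (dF s)) ->
  exists2 s, 0 < s < t & F t - F 0 = t * dF s.
Proof.
move=> t0 dF1.
have [|s] := MVT t0 (fun s _ => dF1 s).
  by apply: derivable_within_continuous => s _; exact: ex_derive.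
by rewrite in_itv /= subr0 => st E; exists s => //; rewrite E mulrC.
Qed.

(** Two applications of the mean value theorem, where [u] and [v] are the basis
    vectors of indices [i] and [j]: first to
    [r |-> g (p + t v + r u) - g (p + r u)], then to the resulting increment of the
    partial derivative along [u]. The left side is symmetric in [i] and [j],
    which is what Schwarz's theorem exploits. *)
Lemma second_difference {R : realType} {k : nat} (g : 'rV[R]_k -> R)
    (p : 'rV[R]_k) (i j : 'I_k) (t : R) : C2 g -> 0 < t ->
  exists r s, [/\ 0 < r < t, 0 < s < t &
    g (p + t *: delta_mx 0 j + t *: delta_mx 0 i) - g (p + t *: delta_mx 0 i)
      - (g (p + t *: delta_mx 0 j) - g p) =
    t * (t * hess g (p + r *: delta_mx 0 i + s *: delta_mx 0 j) j i)].
Proof.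
move=> [[dg _] C2g] t0.
pose u : 'rV[R]_k := delta_mx 0 i; pose v : 'rV[R]_k := delta_mx 0 j.
have Dg q w s := is_derive_line _ _ _ _ (dg (q + s *: w)).
have [r rt E1] := MVT_derivable _ _ _ t0 (fun s =>
  is_deriveB (Dg (p + t *: v) u s) (Dg p u s)).
have Dgi q w s := is_derive_line _ _ _ _ ((C2g i).1 (q + s *: w)).
have [s st E2] := MVT_derivable _ _ _ t0 (Dgi (p + r *: u) v).
exists r, s; split => //.
have {}E1 : g (p + t *: v + t *: u) - g (p + t *: u)
      - (g (p + t *: v + 0 *: u) - g (p + 0 *: u)) =
    t * (dot (grad g (p + t *: v + r *: u)) u - dot (grad g (p + r *: u)) u) := E1.
rewrite !scale0r !addr0 in E1; rewrite E1 !dot_delta; congr (t * _).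
rewrite (addrAC p); move: E2; rewrite scale0r addr0 dot_delta => ->.
by congr (t * _); rewrite [RHS]mxE.
Qed.

Lemma hess_continuous {R : realType} {k : nat} (g : 'rV[R]_k -> R) (a b : 'I_k) :
  C2 g -> continuous (fun q => hess g q a b).
Proof.
move=> C2g p.
have -> : (fun q => hess g q a b) =
    (fun M : 'rV[R]_k => M 0 a) \o grad (fun q => grad g q 0 b).
  by apply/funext => q; rewrite /= mxE.
apply: continuous_comp; last exact: coord_continuous.
exact: (C2g.2 b).2.
Qed.

(** Schwarz's theorem. By [second_difference] taken in both orders, the two
    mixed derivatives agree at two points within [2 t] of [p]; continuity of
    the Hessian brings both points back to [p]. *)
Lemma hess_sym {R : realType} {k : nat} (g : 'rV[R]_k -> R) (p : 'rV[R]_k) :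
  C2 g -> (hess g p)^T = hess g p.
Proof.
move=> C2g; apply/matrixP => i j; rewrite mxE.
have hess_cont a b (e : R) : 0 < e -> exists2 d : R, 0 < d &
    forall h, enorm h <= d -> `|hess g (p + h) a b - hess g p a b| <= e.
  move: e; apply/(continuous_enormP (fun q => hess g q a b)).
  exact: hess_continuous.
apply/eqP; rewrite -subr_eq0 -normr_le0; apply/ler_addgt0Pr => e e0.
rewrite add0r.
have e2 : 0 < e / 2 by rewrite divr_gt0.
have [d1 d10 H1] := hess_cont i j _ e2.
have [d2 d20 H2] := hess_cont j i _ e2.
pose t := Num.min d1 d2 / 2.
have t0 : 0 < t by rewrite divr_gt0 // lt_min d10 d20.
have [r [s [rt st E1]]] := second_difference g p i j t C2g t0.
have [r' [s' [rt' st' E2]]] := second_difference g p j i t C2g t0.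
have small r0 s0 a b : 0 < r0 < t -> 0 < s0 < t ->
    enorm (r0 *: delta_mx 0 a + s0 *: delta_mx 0 b : 'rV[R]_k) <= t + t.
  have n1 (c : 'I_k) : enorm (delta_mx 0 c : 'rV[R]_k) = 1.
    apply/eqP; rewrite -(eqrXn2 (n := 2)) ?enorm_ge0 //.
    by rewrite -dot_enorm dot_delta mxE !eqxx expr1n.
  move=> /andP[r00 r0t] /andP[s00 s0t]; apply: le_trans (enormD _ _) _.
  by rewrite !enormZ !n1 !mulr1 !gtr0_norm // lerD // ltW.
have E : hess g (p + (r *: delta_mx 0 i + s *: delta_mx 0 j)) j i =
         hess g (p + (r' *: delta_mx 0 j + s' *: delta_mx 0 i)) i j.
  rewrite !addrA; do 2 apply: (mulfI (lt0r_neq0 t0)).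
  by rewrite -E1 -E2 (addrAC p) opprB !opprD !addrA; ring.
have tt : t + t = Num.min d1 d2 by rewrite /t -splitr.
have /H1 : enorm (r' *: delta_mx 0 j + s' *: delta_mx 0 i : 'rV[R]_k) <= d1.
  by apply: le_trans (small _ _ _ _ rt' st') _; rewrite tt ge_min lexx.
have /H2 : enorm (r *: delta_mx 0 i + s *: delta_mx 0 j : 'rV[R]_k) <= d2.
  by apply: le_trans (small _ _ _ _ rt st) _; rewrite tt ge_min lexx orbT.
have close (a b c c' : R) : c = c' -> `|c - b| <= e / 2 -> `|c' - a| <= e / 2 ->
    `|b - a| <= e.
  move=> <- cb ca; rewrite [e]splitr.
  by apply: le_trans (ler_distD c _ _) (lerD _ ca); rewrite distrC.
exact: close E.
Qed.

(** The remainder [e] is paired with itself, which reduces the claim to the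
    scalar function [phi t = dot e (grad g (p + t w))]. Subtracting from it its
    tangent at 0 and [M t^2 / 2] gives a function [psi] with nonpositive
    derivative, since [dphi t - dphi 0 <= M t]; then [psi 1 <= psi 0]. *)
Lemma grad_taylor {R : realType} {k : nat} (g : 'rV[R]_k -> R) (p w : 'rV[R]_k)
    (L : R) : C2 g ->
  (forall t : R, 0 <= t <= 1 ->
     opnorm (hess g (p + t *: w) - hess g p) <= L * (t * enorm w)) ->
  enorm (grad g (p + w) - grad g p - w *m hess g p) <= L / 2 * enorm w ^+ 2.
Proof.
move=> C2g HL; set e := (X in enorm X).
pose phi (t : R) := dot e (grad g (p + t *: w)).
pose dphi (t : R) := dot e (w *m hess g (p + t *: w)).
have Dphi (t : R) : is_derive t 1 phi (dphi t).
  have Dj (j : 'I_k) := is_derive_line _ _ _ _ ((C2g.2 j).1 (p + t *: w)).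
  have -> : phi = \sum_(j < k) (e 0 j *: (fun s : R => grad g (p + s *: w) 0 j)).
    by apply/funext => s; rewrite fct_sumE.
  have -> : dphi t = \sum_(j < k)
      e 0 j *: dot (grad (fun q => grad g q 0 j) (p + t *: w)) w.
    apply: eq_bigr => j _; congr (_ * _); rewrite mxE /dot.
    by apply: eq_bigr => i _; rewrite mulrC [in LHS]mxE.
  exact: is_derive_sum.
have [M ME] : exists M, M = L * enorm w ^+ 2 * enorm e by eexists.
pose psi := phi - (dphi 0 *: (id : R -> R)) - (M / 2 *: (id : R -> R) ^+ 2).
have Dpsi (t : R) : is_derive t 1 psi (dphi t - dphi 0 - M * t).
  apply: is_derive_eq.
  move: (dphi t) (dphi 0) => a b; rewrite expr1 /GRing.scale /=.
  by clear; field.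
have [s st E] := MVT_derivable _ _ _ ltr01 Dpsi.
have dle : dphi s - dphi 0 <= M * s.
  rewrite /dphi scale0r addr0 -dotBr -mulmxBr.
  apply: le_trans (dot_le_enorm _ _) _.
  have sym (A B : 'M[R]_k) : A^T = A -> B^T = B -> A - B = (A - B)^T.
    by move=> hA hB; rewrite linearB /= hA hB.
  rewrite (sym _ _ (hess_sym g _ C2g) (hess_sym g _ C2g)).
  rewrite ME mulrC mulrAC; apply: ler_wpM2r; first exact: enorm_ge0.
  apply: le_trans (enorm_mulmx_opnorm _ _) _.
  have /HL H : 0 <= s <= 1 by case/andP: st => ? ?; rewrite !ltW.
  apply: le_trans (ler_wpM2r (enorm_ge0 w) H) _.
  by rewrite le_eqVlt; apply/orP; left; apply/eqP; ring.
have : enorm e * enorm e <= (L / 2 * enorm w ^+ 2) * enorm e.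
  rewrite -expr2 -dot_enorm.
  have -> : dot e e = phi 1 - phi 0 - dphi 0.
    by rewrite /phi /dphi scale0r addr0 scale1r -!dotBr.
  have : psi 1 - psi 0 <= 0 by rewrite E mul1r subr_le0.
  have -> : psi 1 - psi 0 =
      (phi 1 - dphi 0 * 1 - M / 2 * 1 ^+ 2) - (phi 0 - dphi 0 * 0 - M / 2 * 0 ^+ 2).
    by [].
  move: (phi 1) (phi 0) (dphi 0) (enorm w) (enorm e) ME => a b c d f -> {E}.
  by clear; lra.
have := enorm_ge0 e; rewrite le0r => /orP[/eqP ->|e0].
  move=> _; rewrite expr2 mulrA mulr_ge0 ?enorm_ge0 // mulrAC mulr_ge0 //.
  have /HL : 0 <= (1 : R) <= 1 by rewrite ler01 lexx.
  by rewrite mul1r; apply: le_trans; exact: opnorm_ge0.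
by rewrite ler_pM2r.
Qed.

(** * Strongly convex functions *)

(** Divide the convexity inequality at [u + t (v - u)] by [t] and let [t] go
    to 0: the factor [1 - t] tends to 1 and the difference quotient becomes the
    directional derivative. The explicit [t] below keeps each of the two
    discarded terms below half of an arbitrary [eta]. *)
Lemma strongly_convex_tangent {R : realType} {k : nat} (g : 'rV[R]_k -> R)
    (sigma : R) (u v : 'rV[R]_k) : 0 <= sigma -> differentiable g u ->
  strongly_convex sigma g ->
  g u + dot (grad g u) (v - u) + sigma / 2 * enorm (v - u) ^+ 2 <= g v.
Proof.
move=> s0 dg sc; set w := v - u; set N := enorm w.
have N0 : 0 <= N by exact: enorm_ge0.
apply/ler_addgt0Pr => eta eta0.
have e0 : 0 < eta / 2 / (N + 1) by rewrite !divr_gt0 // ltr_wpDl.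
have [d d0 Hd] := differentiable_expansion g u dg _ e0.
have q0 : 0 <= sigma / 2 * N ^+ 2 by rewrite mulr_ge0 ?sqr_ge0 ?divr_ge0.
pose t := Num.min 1 (Num.min (d / (N + 1)) (eta / 2 / (sigma / 2 * N ^+ 2 + 1))).
have t0 : 0 < t by rewrite !lt_min ltr01 !divr_gt0 // ltr_wpDl.
have t1 : t <= 1 by rewrite ge_min lexx.
have td : t * N <= d.
  apply: le_trans (_ : t * (N + 1) <= _); first by rewrite ler_wpM2l ?(ltW t0) ?lerDl.
  by rewrite -ler_pdivlMr ?ltr_wpDl // !ge_min lexx orbT.
have tq : t * (sigma / 2 * N ^+ 2) <= eta / 2.
  apply: le_trans (_ : t * (sigma / 2 * N ^+ 2 + 1) <= _).
    by rewrite ler_wpM2l ?(ltW t0) ?lerDl.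
  by rewrite -ler_pdivlMr ?ltr_wpDl // !ge_min lexx !orbT.
have eN : eta / 2 / (N + 1) * N <= eta / 2.
  rewrite mulrAC ler_pdivrMr ?ltr_wpDl // ler_wpM2l ?lerDl //.
  by rewrite divr_ge0 // ltW.
have nt : enorm (t *: w) = t * N by rewrite enormZ ger0_norm // ltW.
have := Hd (t *: w); rewrite nt => /(_ td); rewrite dotZr ler_norml => /andP[lo _].
have := sc v u t; rewrite (ltW t0) t1 => /(_ isT).
have -> : t *: v + (1 - t) *: u = u + t *: w.
  by rewrite scalerBl scale1r scalerBr addrCA.
rewrite -/w -/N => up.
rewrite -(ler_pM2l t0).
move: (g (u + t *: w)) (g u) (g v) (dot (grad g u) w) lo up => a b c D lo up.
have := ler_wpM2l (ltW t0) tq; have := ler_wpM2l (ltW t0) eN.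
move: (eta / 2 / (N + 1)) lo => E lo eN' tq'.
clear -lo up eN' tq'; lra.
Qed.

(** Adding the tangent inequalities at [u] and at [v] shows that the gradient is
    strongly monotone; Cauchy-Schwarz turns this into a lower bound on the
    variation of the gradient, i.e. an error bound for stationary points. *)
Lemma strongly_convex_grad_dist {R : realType} {k : nat} (g : 'rV[R]_k -> R)
    (sigma : R) (u v : 'rV[R]_k) : 0 <= sigma -> differentiable g u -> differentiable g v ->
  strongly_convex sigma g ->
  sigma * enorm (u - v) <= enorm (grad g u - grad g v).
Proof.
move=> s0 du dv sc.
have := strongly_convex_tangent g sigma u v s0 du sc.
have := strongly_convex_tangent g sigma v u s0 dv sc.
rewrite (enormBC v u) -(opprB u v) dotNr => h1 h2.
have h3 : sigma * enorm (u - v) ^+ 2 <= dot (grad g u - grad g v) (u - v).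
  by rewrite dotBl; clear -h1 h2; lra.
have := enorm_ge0 (u - v); rewrite le0r => /orP[/eqP ->|N0].
  by rewrite mulr0 enorm_ge0.
rewrite -(ler_pM2r N0) -mulrA -expr2; apply: le_trans h3 _.
exact: dot_le_enorm.
Qed.

(** A step of length [d] against a nonzero gradient would decrease [g] by at
    least [d |grad g y| / 2], where [d] is the radius on which the first order
    expansion holds with relative error [|grad g y| / 2]. *)
Lemma argmin_grad0 {R : realType} {k : nat} (g : 'rV[R]_k -> R) (y : 'rV[R]_k) :
  differentiable g y -> argmin g y -> grad g y = 0.
Proof.
move=> dg ymin; apply: enorm_eq0; set N := enorm _.
have := enorm_ge0 (grad g y); rewrite -/N le0r => /orP[/eqP //|N0].
have [d d0 Hd] := differentiable_expansion g y dg _ (divr_gt0 N0 (ltr0Sn R 1)).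
have t0 : 0 < d / N by rewrite divr_gt0.
have E : enorm (- (d / N) *: grad g y) = d / N * N.
  by rewrite enormZ normrN ger0_norm // ltW.
have := Hd (- (d / N) *: grad g y); rewrite E divfK ?gt_eqF // => /(_ (lexx d)).
rewrite dotZr dot_enorm -/N ler_norml => /andP[_].
have := ymin (y + - (d / N) *: grad g y).
rewrite expr2 mulrA mulNr divfK ?gt_eqF //.
have := mulr_gt0 d0 N0; move: (g _) (g _) => a b.
by clear; lra.
Qed.

Lemma enorm_continuous {R : realType} {k : nat} :
  continuous (fun v : 'rV[R]_k => enorm v).
Proof.
move=> v; apply/(continuous_enormP (fun v => enorm v)) => e e0.
exists e => // h he; apply: le_trans (dist_enorm _ _) _.
by rewrite addrC addKr.
Qed.

Lemma compact_eball {R : realType} {k : nat} (r : R) :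
  compact [set v : 'rV[R]_k | enorm v <= r].
Proof.
apply: bounded_closed_compact.
  exists r; split; first exact: num_real.
  by move=> M rM v /= vr; rewrite (le_trans (mx_norm_le_enorm v)) // (le_trans vr) ?ltW.
have -> : [set v : 'rV[R]_k | enorm v <= r] =
    (fun v : 'rV[R]_k => enorm v) @^-1` [set x | x <= r] by [].
apply: closed_comp; last exact: closed_le.
by move=> v _; exact: enorm_continuous.
Qed.

(** Outside the ball of radius [2 |grad g 0| / sigma] the tangent inequality at 0
    forces [g z >= g 0], so a minimizer over this compact ball is global. *)
Lemma strongly_convex_argmin {R : realType} {k : nat} (g : 'rV[R]_k -> R)
    (sigma : R) :
  0 < sigma -> (forall p, differentiable g p) -> strongly_convex sigma g ->
  argmin g !=set0.
Proof.
move=> s0 dg sc; set a := enorm (grad g 0).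
have a0 : 0 <= a by exact: enorm_ge0.
pose r := 2 * a / sigma.
have r0 : 0 <= r by rewrite divr_ge0 ?mulr_ge0 // ltW.
have B0 : [set v : 'rV[R]_k | enorm v <= r] !=set0.
  by exists 0; rewrite /= enorm0.
have [|y yB ymin] := EVT_min_rV B0 (compact_eball r) (f := g).
  by apply: continuous_subspaceT => v; exact: differentiable_continuous.
exists y => z; have [zr|rz] := lerP (enorm z) r; first by apply: ymin; rewrite inE.
apply: le_trans (ymin 0 _) _; first by rewrite inE /= enorm0.
have := strongly_convex_tangent g sigma 0 z (ltW s0) (dg 0) sc; rewrite subr0.
apply: le_trans; rewrite -addrA lerDl.
have := norm_dot_le (grad g 0) z; rewrite -/a ler_norml => /andP[lo _].
move: rz; rewrite ltr_pdivrMr // => rz.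
have := ler_wpM2r (enorm_ge0 z) (ltW rz); move: (dot _ _) (enorm z) lo => D N.
by clear; rewrite expr2; lra.
Qed.

Lemma strongly_convex_growth {R : realType} {k : nat} (g : 'rV[R]_k -> R)
    (sigma : R) (y z : 'rV[R]_k) : 0 <= sigma -> differentiable g y ->
  strongly_convex sigma g -> argmin g y ->
  sigma / 2 * enorm (z - y) ^+ 2 <= g z - g y.
Proof.
move=> s0 dg sc ymin; have := strongly_convex_tangent g sigma y z s0 dg sc.
rewrite argmin_grad0 // dotC dot0r addr0.
by rewrite lerBrDl.
Qed.

(** * Limits of matrices and maxima on compact sets *)

Lemma rV_continuous_enorm {R : realType} {k l : nat} (F : 'rV[R]_k -> 'rV[R]_l)
    (p : 'rV[R]_k) :
  (forall e : R, 0 < e -> exists2 d : R, 0 < d & forall h, enorm h <= d ->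
    enorm (F (p + h) - F p) <= e) ->
  {for p, continuous F}.
Proof.
move=> H; apply: (iffRL (@cvgrPdist_le _ _ _ _ (nbhs_filter p) F (F p))) => e e0.
apply/(near_addP p (fun q => `|F p - F q| <= e)).
have [d d0 Hd] := H e e0; exists d => // h hd /=.
by rewrite distrC; apply: le_trans (mx_norm_le_enorm _) (Hd h hd).
Qed.

(** Estimates are Euclidean whereas continuity refers to the sup norm; this
    handles the linear maps that assemble and split vectors. *)
Lemma enorm_lipschitz_continuous {R : realType} {k l : nat}
    (F : 'rV[R]_k -> 'rV[R]_l) (c : R) : 0 < c ->
  (forall u v, enorm (F u - F v) <= c * enorm (u - v)) -> continuous F.
Proof.
move=> c0 H p; apply: rV_continuous_enorm => e e0; exists (e / c).
  exact: divr_gt0.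
move=> h; rewrite ler_pdivlMr // mulrC; apply: le_trans.
by apply: le_trans (H _ _) _; rewrite addrC addKr.
Qed.

Section CvgMatrix.
Context {R : realType} {T : Type} {F : set_system T} {FF : Filter F}.

Lemma cvg_sumr {I : Type} (s : seq I) (P : pred I) (f : I -> T -> R)
    (a : I -> R) :
  (forall i, P i -> f i t @[t --> F] --> a i) ->
  \sum_(i <- s | P i) f i t @[t --> F] --> \sum_(i <- s | P i) a i.
Proof. by move=> H; apply: cvg_big => //; exact: add_continuous. Qed.

Lemma cvg_prodr {I : Type} (s : seq I) (P : pred I) (f : I -> T -> R)
    (a : I -> R) :
  (forall i, P i -> f i t @[t --> F] --> a i) ->
  \prod_(i <- s | P i) f i t @[t --> F] --> \prod_(i <- s | P i) a i.
Proof. by move=> H; apply: cvg_big => //; exact: mul_continuous. Qed.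

Lemma cvg_det {k : nat} (A : T -> 'M[R]_k) (B : 'M[R]_k) :
  (forall i j, A t i j @[t --> F] --> B i j) -> \det (A t) @[t --> F] --> \det B.
Proof.
move=> H; apply: cvg_sumr => s _.
by apply: cvgM; [exact: cvg_cst|apply: cvg_prodr => i _; exact: H].
Qed.

Lemma cvg_adj {k : nat} (A : T -> 'M[R]_k) (B : 'M[R]_k) :
  (forall i j, A t i j @[t --> F] --> B i j) ->
  forall i j, (\adj (A t)) i j @[t --> F] --> (\adj B) i j.
Proof.
move=> H i j; rewrite mxE.
under eq_fun do rewrite mxE.
apply: cvgM; first exact: cvg_cst.
apply: cvg_det => a b; rewrite !mxE.
by under eq_fun do rewrite !mxE; exact: H.
Qed.

Lemma cvg_mulmx {p q r : nat} (A : T -> 'M[R]_(p, q)) (A' : 'M[R]_(p, q))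
    (B : T -> 'M[R]_(q, r)) (B' : 'M[R]_(q, r)) :
  (forall i j, A t i j @[t --> F] --> A' i j) ->
  (forall i j, B t i j @[t --> F] --> B' i j) ->
  forall i j, (A t *m B t) i j @[t --> F] --> (A' *m B') i j.
Proof.
move=> HA HB i j; rewrite mxE; under eq_fun do rewrite mxE.
by apply: cvg_sumr => l _; apply: cvgM.
Qed.

Lemma cvg_opnorm {p q : nat} (A : T -> 'M[R]_(p, q)) (B : 'M[R]_(p, q)) :
  (forall i j, A t i j @[t --> F] --> B i j) -> opnorm (A t) @[t --> F] --> opnorm B.
Proof.
move=> H; have S : entry_sum (B - A t) @[t --> F] --> (0 : R).
  have -> : (0 : R) = \sum_(j < q) \sum_(i < p) `|B i j - B i j|.
    by rewrite big1 // => j _; rewrite big1 // => i _; rewrite subrr normr0.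
  apply: cvg_sumr => j _; apply: cvg_sumr => i _; apply: cvg_norm.
  under eq_fun do rewrite !mxE.
  by apply: cvgB => //; exact: cvg_cst.
apply/cvgrPdist_le => e e0; have /cvgr0Pnorm_le/(_ e e0) := S.
apply: filterS => t; rewrite ger0_norm ?entry_sum_ge0 //.
by apply: le_trans; exact: dist_opnorm.
Qed.

Lemma cvg_ursubmx {p q r s : nat} (A : T -> 'M[R]_(p + q, r + s))
    (B : 'M[R]_(p + q, r + s)) :
  (forall i j, A t i j @[t --> F] --> B i j) ->
  forall i j, ursubmx (A t) i j @[t --> F] --> ursubmx B i j.
Proof. by move=> H i j; rewrite !mxE; under eq_fun do rewrite !mxE; exact: H. Qed.

Lemma cvg_drsubmx {p q r s : nat} (A : T -> 'M[R]_(p + q, r + s))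
    (B : 'M[R]_(p + q, r + s)) :
  (forall i j, A t i j @[t --> F] --> B i j) ->
  forall i j, drsubmx (A t) i j @[t --> F] --> drsubmx B i j.
Proof. by move=> H i j; rewrite !mxE; under eq_fun do rewrite !mxE; exact: H. Qed.
End CvgMatrix.

Lemma invmx_adj {R : realType} {k : nat} (A : 'M[R]_k) :
  A \in unitmx -> invmx A = (\det A)^-1 *: \adj A.
Proof. by rewrite /invmx => ->. Qed.

(** [invmx] is the identity on singular matrices, hence not continuous; Cramer's
    formula is, near an invertible limit, and agrees with [invmx] on units. *)
Lemma cvg_invmx_adj {R : realType} {T : Type} {F : set_system T} {FF : Filter F}
    {k : nat} (A : T -> 'M[R]_k) (B : 'M[R]_k) : B \in unitmx ->
  (forall i j, A t i j @[t --> F] --> B i j) ->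
  forall i j, ((\det (A t))^-1 *: \adj (A t)) i j @[t --> F] --> invmx B i j.
Proof.
move=> uB H i j; rewrite invmx_adj // mxE; under eq_fun do rewrite mxE.
apply: cvgM; last exact: cvg_adj.
by apply: cvgV; [rewrite -unitfE -unitmxE|exact: cvg_det].
Qed.

Lemma compact_is_max {R : realType} {T : topologicalType} (F : T -> R)
    (A : set T) :
  A !=set0 -> compact A -> (forall t, A t -> {for t, continuous F}) ->
  is_max (F @` A) (sup (F @` A)).
Proof.
move=> A0 cA cF; have [|c cin cmax] := compact_EVT_max A0 cA (f := F).
  by apply: continuous_in_subspaceT => t; rewrite inE => /cF.
rewrite inE in cin.
have ub : ubound (F @` A) (F c) by move=> _ [t At <-]; apply: cmax; rewrite inE.
have -> : sup (F @` A) = F c.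
  apply/eqP; rewrite eq_le; apply/andP; split.
    by apply: ge_sup => //; exists (F c), c.
  by apply: ub_le_sup; [exists (F c)|exists c].
by split=> //; exists c.
Qed.

(** * The lower level problem and the hypergradient *)

Section LowerLevel.
Context {R : realType} {n m : nat}.
Implicit Types (x : 'rV[R]_n) (y : 'rV[R]_m).

Lemma row_mx_addr x y y' : row_mx x (y + y') = row_mx x y + row_mx 0 y'.
Proof. by rewrite add_row_mx addr0. Qed.

(** The partial gradient in [y] is the gradient of the function on which
    strong convexity is assumed. *)
Lemma grad_slice (g : 'rV[R]_(n + m) -> R) x y :
  differentiable g (row_mx x y) ->
  differentiable (fun y' => g (row_mx x y')) y /\
  grad (fun y' => g (row_mx x y')) y = grady g (row_mx x y).
Proof.
move=> dg; apply: expansion_differentiable => e e0.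
have [d d0 Hd] := differentiable_expansion g _ dg e e0.
exists d => // h hd; have := Hd (row_mx 0 h).
rewrite enorm_row_mx0 => /(_ hd).
rewrite -row_mx_addr -[X in dot X _]hsubmxK dot_row_mx dot0r add0r.
by [].
Qed.

Lemma rsubmx_mulmx (A : 'M[R]_(n + m)) x y :
  rsubmx (row_mx x y *m A) = x *m ursubmx A + y *m drsubmx A.
Proof. by rewrite -{1}(submxK A) mul_row_block row_mxKr. Qed.

Lemma lsubmx_mulmx (A : 'M[R]_(n + m)) x y :
  lsubmx (row_mx x y *m A) = x *m ulsubmx A + y *m dlsubmx A.
Proof. by rewrite -{1}(submxK A) mul_row_block row_mxKl. Qed.

Context (ft : 'rV[R]_(n + m) -> R) (sigma : R) (N : set 'rV[R]_n).
Context (ft_C2 : C2 ft) (sigma_gt0 : 0 < sigma) (N_open : open N).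
Context (ft_sconvex : forall x, N x ->
  strongly_convex sigma (fun y => ft (row_mx x y))).

Let ft_diff p : differentiable ft p := ft_C2.1.1 p.

Lemma ystar_argmin x : N x -> argmin (fun y => ft (row_mx x y)) (ystar ft x).
Proof.
move=> Nx; have [y ymin] : argmin (fun y => ft (row_mx x y)) !=set0.
  apply: strongly_convex_argmin sigma_gt0 _ (ft_sconvex _ Nx) => y.
  by have [] := grad_slice ft x y (ft_diff _).
exact: (getPex (ex_intro _ y ymin)).
Qed.

Lemma grady_monotone x y y' : N x ->
  sigma * enorm (y - y') <=
    enorm (grady ft (row_mx x y) - grady ft (row_mx x y')).
Proof.
move=> Nx; have [dy <-] := grad_slice ft x y (ft_diff _).
have [dy' <-] := grad_slice ft x y' (ft_diff _).
exact: strongly_convex_grad_dist (ltW sigma_gt0) dy dy' (ft_sconvex _ Nx).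
Qed.

Lemma grady_ystar x : N x -> grady ft (row_mx x (ystar ft x)) = 0.
Proof.
move=> Nx; have [dy <-] := grad_slice ft x (ystar ft x) (ft_diff _).
exact: argmin_grad0 dy (ystar_argmin _ Nx).
Qed.

(** The error bound on which everything rests: the residual of the optimality
    condition controls the distance to the lower level solution. *)
Lemma ystar_dist_grady x y : N x ->
  sigma * enorm (y - ystar ft x) <= enorm (grady ft (row_mx x y)).
Proof.
move=> Nx; have := grady_monotone x y (ystar ft x) Nx.
by rewrite grady_ystar // subr0.
Qed.

Lemma ystar_dist_value x y : N x ->
  sigma / 2 * enorm (y - ystar ft x) ^+ 2 <=
    ft (row_mx x y) - ft (row_mx x (ystar ft x)).
Proof.
move=> Nx; have [dy _] := grad_slice ft x (ystar ft x) (ft_diff _).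
exact: strongly_convex_growth (ltW sigma_gt0) dy (ft_sconvex _ Nx) (ystar_argmin _ Nx).
Qed.

(** Infinitesimal form of [grady_monotone], obtained for increments [t v] with
    [t] small. It makes [hessyy] invertible. *)
Lemma hessyy_coercive x y v : N x ->
  sigma * enorm v <= enorm (v *m hessyy ft (row_mx x y)).
Proof.
move=> Nx; apply/ler_addgt0Pr => eta eta0.
have v1 : 0 < enorm v + 1 by rewrite ltr_wpDl ?enorm_ge0.
have [d d0 Hd] := grad_expansion ft (row_mx x y) ft_C2 _ (divr_gt0 eta0 v1).
pose t := d / (enorm v + 1); have t0 : 0 < t by rewrite divr_gt0.
have tvd : enorm (t *: v) <= d.
  rewrite enormZ gtr0_norm // mulrAC ler_pdivrMr // ler_wpM2l ?(ltW d0) //.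
  by rewrite lerDl.
have := Hd (row_mx 0 (t *: v)); rewrite enorm_row_mx0 => /(_ tvd) H.
have {H} := le_trans (enorm_rsubmx _) H.
rewrite -row_mx_addr !linearB /= rsubmx_mulmx mul0mx add0r -scalemxAl.
rewrite -/(grady _ _) -/(grady _ _) -/(hessyy _ _).
have := grady_monotone x (y + t *: v) y Nx.
rewrite (addrC y) addrK enormZ gtr0_norm //.
set G := _ - grady _ _; set H := v *m _ => mono H1.
have GH : enorm G <= enorm (t *: H) + enorm (G - t *: H).
  by rewrite -[X in enorm X <= _](subrK (t *: H)) addrC enormD.
rewrite -(ler_pM2l t0) mulrCA; apply: le_trans mono (le_trans GH _).
rewrite enormZ gtr0_norm // mulrDr lerD2l; apply: le_trans H1 _.
rewrite mulrCA ler_wpM2l ?(ltW t0) // mulrAC ler_pdivrMr // ler_wpM2l ?(ltW eta0) //.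
by rewrite lerDl.
Qed.

Lemma hessyy_unit x y : N x -> hessyy ft (row_mx x y) \in unitmx.
Proof.
move=> Nx; rewrite -row_free_unit; apply: inj_row_free => v vA.
apply: enorm_eq0; have := hessyy_coercive x y v Nx; rewrite vA enorm0.
rewrite pmulr_rle0 // => v0.
by apply/eqP; rewrite eq_le v0 enorm_ge0.
Qed.

(** Differentiability of [ystar] without the implicit function theorem: the
    candidate [ystar ft x - h *m K] makes [grady ft] at [x + h] vanish to first
    order, because [K] is chosen so that [h *m hessxy - h *m K *m hessyy = 0];
    by [ystar_dist_grady] the exact solution is then at distance [o(h)] from
    the candidate. *)
Lemma ystar_expansion x : N x ->
  let p := row_mx x (ystar ft x) in
  let K := hessxy ft p *m invmx (hessyy ft p) in
  forall e : R, 0 < e -> exists2 d : R, 0 < d & forall h, enorm h <= d ->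
    enorm (ystar ft (x + h) - ystar ft x + h *m K) <= e * enorm h.
Proof.
move=> Nx p K e e0.
have K0 := entry_sum_ge0 K.
have c0 : 0 < 1 + entry_sum K by rewrite ltr_pwDl.
have e'0 : 0 < e * sigma / (1 + entry_sum K) by rewrite divr_gt0 // mulr_gt0.
have [d d0 Hd] := grad_expansion ft p ft_C2 _ e'0.
have [d' d'0 Nd'] : exists2 d : R, 0 < d & forall h, enorm h <= d -> N (x + h).
  by apply/near_addP; exact: open_nbhs_nbhs.
exists (Num.min d' (d / (1 + entry_sum K))).
  by rewrite lt_min d'0 divr_gt0.
move=> h; rewrite le_min ler_pdivlMr // mulrC => /andP[/Nd' Nxh hd].
(* [k] is the increment from [p] to the candidate point over [x + h]. *)
pose k := row_mx h (- (h *m K)).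
have kh : enorm k <= (1 + entry_sum K) * enorm h.
  apply: le_trans (enorm_row_mx_le _ _) _; rewrite mulrDl mul1r lerD2l enormN.
  exact: enorm_mulmx_le.
have := le_trans (enorm_rsubmx _) (Hd k (le_trans kh hd)).
rewrite !linearB /= rsubmx_mulmx.
rewrite -/(grady _ _) -/(grady _ _) -/(hessyy _ _) -/(hessxy _ _).
rewrite grady_ystar // subr0 mulNmx -mulmxA mulmxKV ?hessyy_unit // subrr subr0.
rewrite add_row_mx => H1.
have := ystar_dist_grady (x + h) (ystar ft x - h *m K) Nxh.
move/le_trans/(_ H1) => H2.
rewrite -(ler_pM2l sigma_gt0) -enormN opprD opprB addrAC.
apply: le_trans H2 _; apply: le_trans (ler_wpM2l (ltW e'0) kh) _.
rewrite mulrA divfK ?gt_eqF //.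
by rewrite mulrCA mulrA.
Qed.

(** The chain rule for [f (x, ystar x)], where [ystar] has derivative [- K] at
    [x]; transposing [K] moves it from the increment to [grady f]. *)
Lemma hyper_objective_grad (f : 'rV[R]_(n + m) -> R) x : N x ->
  let p := row_mx x (ystar ft x) in
  let K := hessxy ft p *m invmx (hessyy ft p) in
  differentiable f p ->
  differentiable (hyper_objective f ft) x /\
  grad (hyper_objective f ft) x = gradx f p - grady f p *m K^T.
Proof.
move=> Nx p K df; apply: expansion_differentiable => e e0.
set b := enorm (grady f p); have b0 : 0 <= b by exact: enorm_ge0.
have b1 : 0 < b + 1 by rewrite ltr_wpDl.
have K0 := entry_sum_ge0 K; have c0 : 0 < 2 + entry_sum K by rewrite ltr_pwDl.
have e20 : 0 < e / 2 by rewrite divr_gt0.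
have e10 : 0 < e / 2 / (2 + entry_sum K) by rewrite divr_gt0.
have e30 : 0 < Num.min 1 (e / 2 / (b + 1)) by rewrite lt_min ltr01 divr_gt0.
have [d1 d10 H1] := differentiable_expansion f p df _ e10.
have [d2 d20 H2] := ystar_expansion x Nx _ e30.
exists (Num.min d2 (d1 / (2 + entry_sum K))); first by rewrite lt_min d20 divr_gt0.
move=> h; rewrite le_min ler_pdivlMr // mulrC => /andP[/H2 rh hd].
have h0 := enorm_ge0 h.
set r := (X in enorm X) in rh.
pose k := row_mx h (r - h *m K).
have kh : enorm k <= (2 + entry_sum K) * enorm h.
  apply: le_trans (enorm_row_mx_le _ _) _.
  have -> : (2 + entry_sum K) * enorm h = enorm h + (1 * enorm h + entry_sum K * enorm h).
    by ring.
  rewrite lerD2l; apply: le_trans (enormB _ _) (lerD _ (enorm_mulmx_le h K)).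
  by apply: le_trans rh _; rewrite ler_wpM2r // ge_min lexx.
have -> : hyper_objective f ft (x + h) = f (p + k).
  by rewrite /hyper_objective /k addrK add_row_mx (addrC (ystar ft x)) subrK.
have dotE : dot (grad f p) k =
    dot (gradx f p - grady f p *m K^T) h + dot (grady f p) r.
  rewrite -[grad f p]hsubmxK -/(gradx f p) -/(grady f p) /k dot_row_mx dotBr.
  by rewrite dot_mulmx dotBl addrAC addrA.
have := H1 k (le_trans kh hd); rewrite dotE opprD addrA => H3.
rewrite -[X in `|X|](subrK (dot (grady f p) r)) [e]splitr mulrDl.
apply: le_trans (ler_normD _ _) (lerD _ _).
  apply: le_trans H3 _; apply: le_trans (ler_wpM2l (ltW e10) kh) _.
  by rewrite mulrA divfK // gt_eqF.
apply: le_trans (norm_dot_le _ _) _; rewrite -/b.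
apply: le_trans (ler_wpM2l b0 rh) _; rewrite mulrA ler_wpM2r //.
apply: le_trans (_ : b * (e / 2 / (b + 1)) <= _).
  by rewrite ler_wpM2l // ge_min lexx orbT.
by rewrite mulrA ler_pdivrMr // mulrC ler_wpM2l ?(ltW e20) // lerDl.
Qed.

Let joint x := row_mx x (ystar ft x).
(** Up to sign, the derivative of [ystar ft] at [x]. *)
Let sens x := hessxy ft (joint x) *m invmx (hessyy ft (joint x)).

Lemma ystar_continuous x : N x -> {for x, continuous (ystar ft)}.
Proof.
move=> Nx; apply: rV_continuous_enorm => e e0.
have [d d0 Hd] := ystar_expansion x Nx 1 ltr01.
have c0 : 0 < 1 + entry_sum (sens x) by rewrite ltr_pwDl // entry_sum_ge0.
exists (Num.min d (e / (1 + entry_sum (sens x)))).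
  by rewrite lt_min d0 divr_gt0.
move=> h; rewrite le_min ler_pdivlMr // mulrC => /andP[/Hd hd]; apply: le_trans.
rewrite -[X in enorm X](addrK (h *m sens x)) mulrDl.
exact: le_trans (enormB _ _) (lerD hd (enorm_mulmx_le _ _)).
Qed.

Lemma row_mx_continuousl : continuous (fun x => row_mx x (0 : 'rV[R]_m)).
Proof.
apply: (enorm_lipschitz_continuous _ _ ltr01) => u v.
rewrite opp_row_mx add_row_mx oppr0 addr0 mul1r.
by apply: le_trans (enorm_row_mx_le _ _) _; rewrite enorm0 addr0.
Qed.

Lemma row_mx_continuousr : continuous (fun y => row_mx (0 : 'rV[R]_n) y).
Proof.
apply: (enorm_lipschitz_continuous _ _ ltr01) => u v.
by rewrite opp_row_mx add_row_mx oppr0 addr0 mul1r enorm_row_mx0.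
Qed.

Lemma cvg_row_mx {T : Type} {F : set_system T} {FF : Filter F}
    (a : T -> 'rV[R]_n) (b : T -> 'rV[R]_m) x y :
  a t @[t --> F] --> x -> b t @[t --> F] --> y ->
  row_mx (a t) (b t) @[t --> F] --> row_mx x y.
Proof.
move=> ax bY.
have E x' y' : row_mx x' y' = row_mx x' 0 + row_mx 0 y' :> 'rV[R]_(n + m).
  by rewrite add_row_mx addr0 add0r.
rewrite E; under eq_fun do rewrite E.
apply: cvgD; first exact: cvg_comp ax (row_mx_continuousl x).
exact: cvg_comp bY (row_mx_continuousr y).
Qed.

(** [ystar] is continuous on [N], which contains the compact set, and so are the
    second derivatives; [invmx] is traded for Cramer's formula so that the
    function maximized is continuous at every point of the set. *)
Lemma sensitivity_opnorm_max (Omega : set 'rV[R]_n) :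
  Omega !=set0 -> compact Omega -> Omega `<=` N ->
  is_max [set opnorm (sens x) | x in Omega] (sup [set opnorm (sens x) | x in Omega]).
Proof.
move=> O0 Oc ON.
pose adjK x := hessxy ft (joint x) *m
  ((\det (hessyy ft (joint x)))^-1 *: \adj (hessyy ft (joint x))).
have adjE x : N x -> adjK x = sens x.
  by move=> Nx; rewrite /adjK /sens invmx_adj // hessyy_unit.
have -> : [set opnorm (sens x) | x in Omega] = [set opnorm (adjK x) | x in Omega].
  by apply/seteqP; split=> _ [x Ox <-]; exists x; rewrite ?adjE //; exact: ON.
apply: compact_is_max => // x Ox; have Nx := ON _ Ox.
have jc : joint t @[t --> x] --> joint x.
  exact: (@cvg_row_mx _ _ (nbhs_filter x) _ _ _ _ cvg_id (ystar_continuous _ Nx)).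
have hc a b : hess ft (joint t) a b @[t --> x] --> hess ft (joint x) a b.
  exact: cvg_comp jc (hess_continuous ft a b ft_C2 _).
have ux : hessyy ft (joint x) \in unitmx by exact: hessyy_unit.
have fx : Filter (nbhs x) := nbhs_filter x.
have : opnorm (adjK t) @[t --> x] --> opnorm (sens x) :=
  cvg_opnorm _ _ (cvg_mulmx _ _ _ _ (cvg_ursubmx _ _ hc)
    (cvg_invmx_adj _ _ ux (cvg_drsubmx _ _ hc))).
by move=> /(_ fx fx fx); rewrite -adjE.
Qed.

(** The tube around the graph of [ystar] is the continuous image of the compact
    product of [Omega] with a ball, under [(x, v) |-> (x, ystar x + v)]. *)
Lemma grady_tube_max (f : 'rV[R]_(n + m) -> R) (Omega : set 'rV[R]_n) (r : R) :
  continuous (grad f) -> 0 <= r ->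
  Omega !=set0 -> compact Omega -> Omega `<=` N ->
  let S := [set c : R | exists x y, [/\ Omega x, enorm (y - ystar ft x) <= r
    & c = enorm (grady f (row_mx x y))]] in
  is_max S (sup S).
Proof.
move=> cf r0 O0 Oc ON S.
pose F (z : 'rV[R]_n * 'rV[R]_m) := enorm (grady f (row_mx z.1 (ystar ft z.1 + z.2))).
have -> : S = [set F z | z in Omega `*` [set v : 'rV[R]_m | enorm v <= r]].
  apply/seteqP; split=> [_ [x [y [Ox yr ->]]]|_ [[x v] [/= Ox vr] <-]].
    exists (x, y - ystar ft x); first by split.
    by rewrite /F /= (addrC (ystar ft x)) subrK.
  by exists x, (ystar ft x + v); rewrite addrC addKr.
apply: compact_is_max.
- by case: O0 => x Ox; exists (x, 0); split; rewrite //= enorm0.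
- by apply: compact_setX => //; exact: compact_eball.
move=> [x v] [/= Ox _]; have Nx := ON _ Ox.
have rsub : continuous (@rsubmx R 1 n m).
  apply: (enorm_lipschitz_continuous _ _ ltr01) => a b.
  by rewrite mul1r -linearB enorm_rsubmx.
have jc : row_mx z.1 (ystar ft z.1 + z.2) @[z --> (x, v)] -->
    row_mx x (ystar ft x + v).
  have c1 : z.1 @[z --> (x, v)] --> x by exact: cvg_fst.
  have c2 : z.2 @[z --> (x, v)] --> v by exact: cvg_snd.
  apply: cvg_row_mx => //; apply: cvgD => //.
  exact: (cvg_comp _ _ c1 (ystar_continuous _ Nx)).
exact: (cvg_comp _ _ (cvg_comp _ _ (cvg_comp _ _ jc (cf _)) (rsub _))
  (enorm_continuous _)).
Qed.

(** Multiplication by the block column [P] of [1%:M] and [- (sens x)^T] sends a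
    stacked vector [(a; b)] to [a - b *m (sens x)^T], so it sends
    [grad f (joint x)] to the hypergradient.
    It annihilates [row_mx 0 v *m hess ft (joint x)], because the Hessian is
    symmetric: the linear parts of the variation of [grad ft] between [y], [z]
    and [ystar ft x] disappear although they are multiplied by the possibly
    huge [rho]. What remains are the two residuals of the KKT conditions, the
    variation of [grad f], and [rho] times second order Taylor remainders. *)
Lemma hypergradient_bound (f : 'rV[R]_(n + m) -> R) x y z (eps rho L1 L2 : R) :
  N x -> 0 <= rho ->
  (forall y1 y2 : 'rV[R]_m,
     enorm (grad f (row_mx x y1) - grad f (row_mx x y2)) <= L1 * enorm (y1 - y2)) ->
  (forall y1 y2 : 'rV[R]_m,
     opnorm (hess ft (row_mx x y1) - hess ft (row_mx x y2)) <= L2 * enorm (y1 - y2)) ->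
  enorm (grad f (row_mx x y) + rho *: grad ft (row_mx x y)
           - row_mx (rho *: gradx ft (row_mx x z)) 0) <= eps ->
  enorm (rho *: grady ft (row_mx x z)) <= eps ->
  enorm (gradx f (joint x) - grady f (joint x) *m (sens x)^T) <=
    (2 * opnorm (sens x) + 1) * eps + (opnorm (sens x) + 1) *
      (L1 * enorm (y - ystar ft x)
       + rho * (L2 / 2 * enorm (y - ystar ft x) ^+ 2
                + L2 / 2 * enorm (z - ystar ft x) ^+ 2)).
Proof.
move=> Nx rho0 flip ftlip kkt1 kkt2.
set kap := opnorm (sens x); have kap0 : 0 <= kap by exact: opnorm_ge0.
set s := joint x; set ys := ystar ft x.
set P := col_mx 1%:M (- (sens x)^T).
have PE (w : 'rV[R]_(n + m)) : w *m P = lsubmx w - rsubmx w *m (sens x)^T.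
  by rewrite -{1}(hsubmxK w) mul_row_col mulmx1 mulmxN.
have Ple w : enorm (w *m P) <= (kap + 1) * enorm w.
  rewrite PE; apply: le_trans (enormB _ _) _.
  rewrite mulrDl mul1r addrC lerD ?enorm_lsubmx //.
  apply: le_trans (enorm_mulmx_opnorm _ _) _.
  by rewrite ler_wpM2l ?enorm_rsubmx.
have Pker (v : 'rV[R]_m) : row_mx 0 v *m hess ft s *m P = 0.
  rewrite PE lsubmx_mulmx rsubmx_mulmx !mul0mx !add0r /sens trmx_mul trmx_inv.
  rewrite /hessyy trmx_drsub /hessxy trmx_ursub (hess_sym _ _ ft_C2).
  rewrite mulmxA mulmxK ?subrr //.
  exact: hessyy_unit.
pose rem v := grad ft (row_mx x v) - grad ft s - row_mx 0 (v - ys) *m hess ft s.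
have reml v : enorm (rem v) <= L2 / 2 * enorm (v - ys) ^+ 2.
  have -> : rem v = grad ft (s + row_mx 0 (v - ys)) - grad ft s
                      - row_mx 0 (v - ys) *m hess ft s.
    by rewrite -row_mx_addr [ystar _ _ + _]addrC subrK.
  rewrite -(enorm_row_mx0 (n := n) (v - ys)); apply: grad_taylor => // t /andP[t0 _].
  rewrite enorm_row_mx0 scale_row_mx scaler0 -row_mx_addr.
  apply: le_trans (ftlip _ _) _.
  by rewrite (addrC (ystar _ _)) addrK enormZ ger0_norm.
set r := (X in enorm X <= eps) in kkt1; set r3 := (X in enorm X <= eps) in kkt2.
(* [r] is the stationarity residual and [r3] the residual of [z]; subtracting
   [row_mx (rho *: gradx ft _) 0] in [r] amounts to subtracting the full
   gradient at [z] and giving back its second block, which is [r3]. *)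
have key : grad f s *m P = (r *m P + r3 *m (sens x)^T)
    + ((grad f s - grad f (row_mx x y)) *m P - rho *: ((rem y - rem z) *m P)).
  have remP v : rem v *m P = grad ft (row_mx x v) *m P - grad ft s *m P.
    by rewrite /rem mulmxBl Pker subr0 mulmxBl.
  have rP : r *m P + r3 *m (sens x)^T = grad f (row_mx x y) *m P
      + (rho *: (grad ft (row_mx x y) *m P) - rho *: (grad ft (row_mx x z) *m P)).
    have -> : r3 *m (sens x)^T = - (row_mx 0 r3 *m P).
      by rewrite PE row_mxKl row_mxKr sub0r opprK.
    rewrite /r mulmxBl -addrA -opprD -mulmxDl add_row_mx addr0 add0r.
    rewrite /r3 -scale_row_mx (hsubmxK (grad ft _)) mulmxDl -!scalemxAl.
    by rewrite addrA.
  have -> : (rem y - rem z) *m P = rem y *m P - rem z *m P by exact: mulmxBl.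
  rewrite rP !remP opprB subrKA mulmxBl scalerBr.
  have zE (a b c : 'rV[R]_n) : a = b + c + (a - b - c).
    by rewrite -(addrA a) -opprD [RHS]addrC subrK.
  exact: zE.
rewrite -PE key.
have B1 : enorm (r *m P + r3 *m (sens x)^T) <= (2 * kap + 1) * eps.
  apply: le_trans (enormD _ _) _.
  have -> : (2 * kap + 1) * eps = (kap + 1) * eps + kap * eps by ring.
  apply: lerD; first by apply: le_trans (Ple _) _; rewrite ler_wpM2l ?addr_ge0.
  by apply: le_trans (enorm_mulmx_opnorm _ _) _; rewrite ler_wpM2l.
apply: le_trans (enormD _ _) (lerD B1 _).
apply: le_trans (enormB _ _) _; rewrite mulrDr; apply: lerD.
  apply: le_trans (Ple _) _; rewrite ler_wpM2l ?addr_ge0 //.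
  by rewrite (enormBC y); exact: flip.
rewrite enormZ ger0_norm // mulrCA ler_wpM2l //.
apply: le_trans (Ple _) _; rewrite ler_wpM2l ?addr_ge0 //.
exact: le_trans (enormB _ _) (lerD (reml y) (reml z)).
Qed.
End LowerLevel.

(** * The error terms in powers of the accuracy *)

Lemma powR3half {R : realType} (a : R) : 0 <= a -> a `^ (3 / 2) = a * Num.sqrt a.
Proof.
move=> a0; have -> : 3 / 2 = 1 + 2^-1 :> R by field.
rewrite powRD; first by rewrite powRr1 // powR12_sqrt.
by apply/implyP; rewrite gt_eqF // addr_gt0 // invr_gt0.
Qed.

(** One factor [theta] of [theta ^+ 2] is bounded by [(eps + Cbar) / (rho sigma)],
    which absorbs [rho], and the other one by [sqrt (2 eps / sigma)], which
    provides [sqrt eps]. *)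
Lemma error_terms_sqrt_bound {R : realType}
    (sigma rho rho0 eps eps0 L1 L2 Cbar theta : R) :
  0 < sigma -> 0 < rho0 -> rho0 <= rho -> 0 < eps -> eps <= eps0 ->
  0 <= L1 -> 0 <= L2 -> 0 <= Cbar -> 0 <= theta ->
  theta <= (rho * sigma)^-1 * (eps + Cbar) ->
  theta <= Num.sqrt (2 * sigma^-1 * eps) ->
  L1 * theta + L2 * rho * theta ^+ 2 / 2 + L2 * eps ^+ 2 / (2 * rho * sigma ^+ 2) <=
  (L1 * Num.sqrt (2 * sigma^-1)
    + L2 * (sigma `^ (- (3 / 2))) * (eps0 + Cbar) / Num.sqrt 2
    + (eps0 `^ (3 / 2)) * L2 / (2 * rho0 * sigma ^+ 2)) * Num.sqrt eps.
Proof.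
move=> s0 r00 rr e0 ee L10 L20 Cb0 th0 th1 th2.
have r0 : 0 < rho by exact: lt_le_trans rr.
have eps00 : 0 < eps0 by exact: lt_le_trans ee.
have thE : Num.sqrt (2 * sigma^-1 * eps) = Num.sqrt (2 * sigma^-1) * Num.sqrt eps.
  by rewrite sqrtrM // mulr_ge0 // invr_ge0 ltW.
rewrite 2!(mulrDl _ _ (Num.sqrt eps)); apply: lerD; first apply: lerD.
- by rewrite -mulrA -thE ler_wpM2l.
- rewrite powRN powR3half; last exact: ltW.
  apply: le_trans (_ : L2 * rho * ((rho * sigma)^-1 * (eps0 + Cbar)
      * (Num.sqrt (2 * sigma^-1) * Num.sqrt eps)) / 2 <= _).
    rewrite ler_wpM2r ?invr_ge0 // ler_wpM2l ?mulr_ge0 ?(ltW r0) // expr2.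
    apply: ler_pM => //; last by rewrite -thE.
    apply: le_trans th1 _; rewrite ler_wpM2l ?invr_ge0 ?mulr_ge0 ?(ltW r0) ?(ltW s0) //.
    by rewrite lerD2r.
  have q0 : 0 < Num.sqrt sigma by rewrite sqrtr_gt0.
  have t0 : 0 < Num.sqrt 2 :> R by rewrite sqrtr_gt0.
  have t2 : Num.sqrt 2 * Num.sqrt 2 = 2 :> R by rewrite -expr2 sqr_sqrtr.
  have -> : Num.sqrt (2 * sigma^-1) = Num.sqrt 2 / Num.sqrt sigma.
    by rewrite sqrtrM // sqrtrV // ltW.
  rewrite le_eqVlt; apply/orP; left; apply/eqP.
  rewrite -{2}t2; field.
  by rewrite !gt_eqF.
- rewrite powR3half; last exact: ltW.
  have -> : eps0 * Num.sqrt eps0 * L2 / (2 * rho0 * sigma ^+ 2) * Num.sqrt eps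
    = L2 * (eps0 * Num.sqrt eps0 * Num.sqrt eps) / (2 * rho0 * sigma ^+ 2).
    by field; rewrite !gt_eqF.
  apply: ler_pM.
  + by rewrite mulr_ge0 ?sqr_ge0.
  + by rewrite invr_ge0 !mulr_ge0 ?(ltW r0) ?(ltW s0).
  + rewrite ler_wpM2l // -{1}(sqr_sqrtr (ltW e0)) -exprM.
    rewrite -{1}(sqr_sqrtr (ltW eps00)).
    have qe : 0 <= Num.sqrt eps by exact: sqrtr_ge0.
    have qq : Num.sqrt eps <= Num.sqrt eps0 by rewrite ler_wsqrtr.
    rewrite -exprSr [leLHS](exprSr _ 3) ler_wpM2r //.
    by rewrite lerXn2r // nnegrE sqrtr_ge0.
  + rewrite lef_pV2 ?posrE ?mulr_gt0 ?exprn_gt0 //.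
    by rewrite ler_wpM2r ?sqr_ge0 // ler_wpM2l.
Qed.

(** Test the bound on two distinct points, which exist because [m > 0]. *)
Lemma lipschitz_const_ge0 {R : realType} {m : nat} (L : R)
    (F : 'rV[R]_m -> 'rV[R]_m -> R) : (0 < m)%N ->
  (forall y1 y2, F y1 y2 <= L * enorm (y1 - y2)) ->
  (forall y1 y2, 0 <= F y1 y2) -> 0 <= L.
Proof.
move=> m0 lip F0; have H0 := F0 (const_mx 1) 0; have H1 := lip (const_mx 1) 0.
rewrite leNgt; apply/negP => L0.
have : enorm (const_mx 1 - 0 : 'rV[R]_m) <= 0.
  by rewrite -(nmulr_rge0 _ L0); apply: le_trans H1.
rewrite subr0 => E.
have := coord_le_enorm (const_mx 1 : 'rV[R]_m) (Ordinal m0).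
by rewrite mxE normr1 => /le_trans/(_ E); rewrite ler10.
Qed.

Theorem theorem2 (R : realType) (n m : nat) (n_gt0 : (0 < n)%N)
  (m_gt0 : (0 < m)%N) (eps0 rho0 : R) (eps0_gt0 : 0 < eps0) (rho0_gt0 : 0 < rho0)
  (Omega : set 'rV[R]_n) (Omega_nonempty : Omega !=set0)
  (Omega_compact : compact Omega)
  (f ft : 'rV[R]_(n + m) -> R) (f_C1 : C1 f) (ft_C2 : C2 ft)
  (sigma : R) (sigma_gt0 : 0 < sigma)
  (N : set 'rV[R]_n) (N_open : open N) (Omega_sub_N : Omega `<=` N)
  (ft_sconvex : forall x', N x' ->
     strongly_convex sigma (fun y' => ft (row_mx x' y')))
  (L1 L2 : R)
  (f_lip : forall x', Omega x' -> forall y1 y2 : 'rV[R]_m,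
     enorm (grad f (row_mx x' y1) - grad f (row_mx x' y2))
       <= L1 * enorm (y1 - y2))
  (ft_lip : forall x', Omega x' -> forall y1 y2 : 'rV[R]_m,
     opnorm (hess ft (row_mx x' y1) - hess ft (row_mx x' y2))
       <= L2 * enorm (y1 - y2))
  (eps : R) (eps_gt0 : 0 < eps) (eps_le : eps <= eps0)
  (x : 'rV[R]_n) (y : 'rV[R]_m) (x_in : Omega x)
  (rho : R) (rho_ge : rho0 <= rho)
  (xy_KKT : eps_KKT_with f ft eps x y rho) :
  let Cbar_set := [set c : R | exists x' y',
    [/\ Omega x', enorm (y' - ystar ft x') <= Num.sqrt (2 * sigma^-1 * eps)
      & c = enorm (grady f (row_mx x' y'))]] in
  let Cbar := sup Cbar_set in
  let theta := Num.min ((rho * sigma)^-1 * (eps + Cbar))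
                       (Num.sqrt (2 * sigma^-1 * eps)) in
  let C_set := [set c : R | exists2 x', Omega x' &
    c = opnorm (hessxy ft (row_mx x' (ystar ft x'))
                *m invmx (hessyy ft (row_mx x' (ystar ft x'))))] in
  let C := sup C_set in
  let Phi := hyper_objective f ft in
  let bound1 := (2 * C + 1) * eps
    + (C + 1) * (L1 * theta + L2 * rho * theta ^+ 2 / 2
                 + L2 * eps ^+ 2 / (2 * rho * sigma ^+ 2)) in
  let bound2 := (2 * C + 1) * eps
    + (C + 1) * (L1 * Num.sqrt (2 * sigma^-1)
                 + L2 * (sigma `^ (- (3 / 2))) * (eps0 + Cbar) / Num.sqrt 2
                 + (eps0 `^ (3 / 2)) * L2 / (2 * rho0 * sigma ^+ 2))
      * Num.sqrt eps in
  [/\ is_max Cbar_set Cbar, is_max C_set C, differentiable Phi x,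
      enorm (grad Phi x) <= bound1
    & bound1 <= bound2].
Proof.
move=> Cbar_set Cbar theta C_set C Phi bound1 bound2.
have [rho_ge0 [z [kkt1 kkt2 kkt3]]] := xy_KKT.
have rho_gt0 : 0 < rho by exact: lt_le_trans rho_ge.
have Nx : N x by exact: Omega_sub_N.
have Cbar_max : is_max Cbar_set Cbar.
  exact: (grady_tube_max ft sigma N ft_C2 sigma_gt0 N_open ft_sconvex f Omega _
    f_C1.2 (sqrtr_ge0 _) Omega_nonempty Omega_compact Omega_sub_N).
have C_max : is_max C_set C.
  have E : C_set = [set opnorm (hessxy ft (row_mx x' (ystar ft x'))
      *m invmx (hessyy ft (row_mx x' (ystar ft x')))) | x' in Omega].
    by apply/seteqP; split=> [_ [x' Ox' ->]|_ [x' Ox' <-]]; exists x'.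
  rewrite /C E.
  exact: (sensitivity_opnorm_max ft sigma N ft_C2 sigma_gt0 N_open ft_sconvex Omega
    Omega_nonempty Omega_compact Omega_sub_N).
have [dPhi gPhi] := hyper_objective_grad ft sigma N ft_C2 sigma_gt0 N_open
  ft_sconvex f x Nx (f_C1.1 _).
have Cbar_ge0 : 0 <= Cbar.
  by have [[x' [y' [_ _ ->]]] _] := Cbar_max; exact: enorm_ge0.
have L1_ge0 : 0 <= L1.
  exact: (lipschitz_const_ge0 _ _ m_gt0 (f_lip x x_in) (fun _ _ => enorm_ge0 _)).
have L2_ge0 : 0 <= L2.
  exact: (lipschitz_const_ge0 _ _ m_gt0 (ft_lip x x_in) (fun _ _ => opnorm_ge0 _)).
set ys := ystar ft x in gPhi *.
(* Quadratic growth turns the gap in the lower level value into a distance;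
   this places [y] in the tube over which [Cbar] is a maximum. *)
have y_near : enorm (y - ys) <= Num.sqrt (2 * sigma^-1 * eps).
  have gap := ystar_dist_value ft sigma N ft_C2 sigma_gt0 ft_sconvex x y Nx.
  have ysmin := ystar_argmin ft sigma N ft_C2 sigma_gt0 ft_sconvex x Nx.
  have infle : inf (range (fun z' => ft (row_mx x z'))) <= ft (row_mx x ys).
    apply: ge_inf; last by exists ys.
    by exists (ft (row_mx x ys)) => _ [z' _ <-]; exact: ysmin.
  have {}gap : sigma / 2 * enorm (y - ys) ^+ 2 <= eps.
    by apply: le_trans gap (le_trans _ kkt3); rewrite lerD2l lerN2.
  rewrite -[leLHS]ger0_norm ?enorm_ge0 // -sqrtr_sqr ler_wsqrtr //.
  have -> : 2 * sigma^-1 * eps = (sigma / 2)^-1 * eps by rewrite invf_div.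
  by rewrite ler_pdivlMl // divr_gt0.
(* The second block of the stationarity condition makes [grady ft] of order
   [1 / rho] at [y]. *)
have y_near' : enorm (y - ys) <= (rho * sigma)^-1 * (eps + Cbar).
  rewrite ler_pdivlMl ?mulr_gt0 // -mulrA.
  have := ystar_dist_grady ft sigma N ft_C2 sigma_gt0 ft_sconvex x y Nx.
  move/(ler_wpM2l rho_ge0)/le_trans; apply.
  rewrite -[leLHS]/(rho * enorm _) -{1}(ger0_norm rho_ge0) -enormZ.
  have -> : rho *: grady ft (row_mx x y) =
      rsubmx (grad f (row_mx x y) + rho *: grad ft (row_mx x y)
               - row_mx (rho *: gradx ft (row_mx x z)) 0) - grady f (row_mx x y).
    by rewrite !linearD /= linearN /= row_mxKr subr0 linearZ /= addrC addKr.
  apply: le_trans (enormB _ _) (lerD (le_trans (enorm_rsubmx _) kkt1) _).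
  by apply: Cbar_max.2; exists x, y; split.
have z_near : rho * sigma * enorm (z - ys) <= eps.
  rewrite -mulrA.
  have := ystar_dist_grady ft sigma N ft_C2 sigma_gt0 ft_sconvex x z Nx.
  move/(ler_wpM2l rho_ge0)/le_trans; apply.
  by rewrite -{1}(ger0_norm rho_ge0) -enormZ.
have y_theta : enorm (y - ys) <= theta by rewrite le_min y_near' y_near.
have theta_ge0 : 0 <= theta by exact: le_trans (enorm_ge0 _) y_theta.
set kap := opnorm (hessxy ft (row_mx x ys) *m invmx (hessyy ft (row_mx x ys))).
have kapC : kap <= C by apply: C_max.2; exists x.
have kap_ge0 : 0 <= kap by exact: opnorm_ge0.
have C_ge0 : 0 <= C by exact: le_trans kapC.
split => //.
- rewrite gPhi.
  apply: le_trans (hypergradient_bound ft sigma N ft_C2 sigma_gt0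
    ft_sconvex f x y z eps rho L1 L2 Nx rho_ge0 (f_lip _ x_in)
    (ft_lip _ x_in) kkt1 kkt2) _.
  rewrite -/ys -/kap /bound1; apply: lerD.
    by rewrite ler_wpM2r ?(ltW eps_gt0) // lerD2r ler_wpM2l.
  have inner : L1 * enorm (y - ys) + rho * (L2 / 2 * enorm (y - ys) ^+ 2
        + L2 / 2 * enorm (z - ys) ^+ 2)
      <= L1 * theta + L2 * rho * theta ^+ 2 / 2
         + L2 * eps ^+ 2 / (2 * rho * sigma ^+ 2).
    have -> : L1 * enorm (y - ys) + rho * (L2 / 2 * enorm (y - ys) ^+ 2
          + L2 / 2 * enorm (z - ys) ^+ 2) =
        L1 * enorm (y - ys) + L2 * rho * enorm (y - ys) ^+ 2 / 2
          + L2 / 2 * (rho * enorm (z - ys) ^+ 2) by ring.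
    have -> : L2 * eps ^+ 2 / (2 * rho * sigma ^+ 2) =
        L2 / 2 * (eps ^+ 2 / (rho * sigma ^+ 2)).
      by field; rewrite !gt_eqF.
    apply: lerD; first apply: lerD.
    - by rewrite ler_wpM2l.
    - rewrite ler_wpM2r ?invr_ge0 // ler_wpM2l ?mulr_ge0 //.
      by rewrite lerXn2r // nnegrE enorm_ge0.
    - rewrite ler_wpM2l ?divr_ge0 // ler_pdivlMr ?mulr_gt0 ?exprn_gt0 //.
      have -> : rho * enorm (z - ys) ^+ 2 * (rho * sigma ^+ 2) =
          (rho * sigma * enorm (z - ys)) ^+ 2 by ring.
      by rewrite lerXn2r // nnegrE ?mulr_ge0 ?enorm_ge0 ?(ltW sigma_gt0) ?(ltW eps_gt0).
  apply: ler_pM => //.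
  + by rewrite addr_ge0.
  + by rewrite addr_ge0 ?mulr_ge0 ?addr_ge0 ?mulr_ge0 ?enorm_ge0 ?sqr_ge0 ?divr_ge0.
  + by rewrite lerD2r.
- rewrite /bound1 /bound2 lerD2l -(mulrA (C + 1)) ler_wpM2l ?addr_ge0 //.
  apply: (error_terms_sqrt_bound sigma rho) => //; first by rewrite ge_min lexx.
  by rewrite ge_min lexx orbT.
Qed.
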